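(* Let $d\in\{2,3\}$, $\Delta t>0$, $\alpha\ge0$, and let $\Gamma^m\subset\mathbb R^d$ be a connected polyhedral surface with triangulation $\mathcal T^m$, vertex normals $\vec\nu_{h,p}^m$ and set of free vertices $\mathcal Q_{\rm f}^m$. Let the data $\vec k^m\in[\mathbb V^m]^d$, $\overline{\varkappa}^m\in\mathbb V^m$ and $\vec\mu_\partial^h$ be given, and let $\theta_A^m=I_h^m(\vec k^m\cdot\vec\nu_{h,p}^m+\overline{\varkappa}^m)\in\mathbb V^m$. Assume: (A1) $\mathcal H^{d-1}(\sigma)>0$ for all $\sigma\in\mathcal T^m$; (A2) $\dim\operatorname{span}\bigl(\{\vec\nu_{h,p}^m(\vec q)\}_{\vec q\in\mathcal Q_{\rm f}^m}\bigr)=d$; (A3) $\vec\nu_{h,p}^m(\vec q)\ne\vec0$ for all $\vec q\in\mathcal Q_{\rm f}^m$; (B1) there exist $\vec q_i^m,\vec q_j^m\in\mathcal Q_{\rm f}^m$ such that $\theta_A^m(\vec q_i^m)\ne\theta_A^m(\vec q_j^m)$. Then the fully discrete Helfrich scheme has a unique solution; that is, there is exactly one $(\vec w^{m+1},\vec k^{m+1},\lambda^{m+1},\vec p^{m+1},\lambda_A^{m+1},\lambda_V^{m+1})\in[\mathbb V_0^m]^d\times[\mathbb V_1^m]^d\times\mathbb V_0^m\times[\mathbb V_0^m]^d\times\mathbb R\times\mathbb R$ such that $$\begin{aligned} 0={}&(\vec w^{m+1}\cdot\vec\nu^m,\vec\chi^h\cdot\vec\nu^m)^h_{\Gamma^m}-\mathcal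 B_h^m(\vec k^{m+1},\overline{\varkappa}^m;\vec\chi^h)+(P_{\Gamma^m}\vec\chi^h,\vec p^{m+1})^h_{\Gamma^m}+\alpha(\nabla_s\vec\chi^h,\nabla_s\vec p^{m+1})_{\Gamma^m}\\ &+\lambda_A^{m+1}(\theta_A^m\vec\nu^m,\vec\chi^h)^h_{\Gamma^m}+\lambda_V^{m+1}(\vec\nu^m,\vec\chi^h)^h_{\Gamma^m},\\ 0={}&(\vec k^{m+1}+\overline{\varkappa}^m\vec\nu^m,\vec\eta^h)^h_{\Gamma^m}+(\nabla_s(\vec{\rm id}|_{\Gamma^m}+\Delta t\,\vec w^{m+1}),\nabla_s\vec\eta^h)_{\Gamma^m}-(\vec\mu_\partial^h,\vec\eta^h)_{\partial_2\Gamma^m},\\ 0={}&(\rho^h\vec\nu^m,\vec p^{m+1})^h_{\Gamma^m},\\ 0={}&(P_{\Gamma^m}\vec w^{m+1},\vec\xi^h)^h_{\Gamma^m}+(\lambda^{m+1}\vec\nu^m,\vec\xi^h)^h_{\Gamma^m}+\alpha(\nabla_s\vec w^{m+1},\nabla_s\vec\xi^h)_{\Gamma^m},\\ 0={}&(\vec w^{m+1},\vec\nu^m)^h_{\Gamma^m},\\ 0={}&(\theta_A^m\vec\nu^m,\vec w^{m+1})^h_{\Gamma^m} \end{aligned}$$ for all $(\vec\chi^h,\vec\eta^h,\rho^h,\vec\xi^h)\in[\mathbb V_0^m]^d\times[\mathbb V_1^m]^d\times\mathbb V_0^m\times[\mathbb V_0^m]^d$.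
   Context: Polyhedral surface: $\Gamma^m=\bigcup_{j=1}^J\overline{\sigma_j^m}\subset\mathbb R^d$, where $\mathcal T^m=\{\sigma_j^m\}_{j=1}^J$ are mutually disjoint consistently oriented $(d-1)$-simplices, with set of vertices $\mathcal Q^m=\{\vec q_k^m\}_{k=1}^K$. The boundary is $\partial\Gamma^m=\partial_1\Gamma^m\cup\partial_2\Gamma^m$ (disjoint partition; all boundary sets are empty for closed surfaces). If $\vec q_{j_0}^m,\dots,\vec q_{j_{d-1}}^m$ are the consistently oriented vertices of $\sigma_j^m$, the elementwise constant unit normal is $\vec\nu^m|_{\sigma_j^m}=\vec\nu_j^m=\vec N/|\vec N|$ with $\vec N=(\vec q_{j_1}^m-\vec q_{j_0}^m)\wedge\cdots\wedge(\vec q_{j_{d-1}}^m-\vec q_{j_0}^m)$ (generalized wedge product giving an oriented normal vector). $P_{\Gamma^m}={\rm Id}-\vec\nu^m\otimes\vec\nu^m$ elementwise. $\mathcal Q_{\rm f}^m=\{\vec q\in\mathcal Q^m:\vec q\notin\partial\Gamma^m\}$ is the set of free vertices. With $\mathcal I_k^m=\{j:\vec q_k^m\in\overline{\sigma_j^m}\}$, the vertex normal $\vec\nu_{h,p}^m\in[\mathbb V^m]^d$ is given by $$\vec\nu_{h,p}^m(\vec q_k^m)=\frac{\sum_{j\in\mathcal I_k^m}\mathcal H^{d-1}(\sigma_j^m)\,\vec\nu_j^m}{\sum_{j\in\mathcal I_k^m}\mathcal H^{d-1}(\sigma_j^m)},\qquad k=1,\dots,K.$$ Spaces: $\mathbb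 V^m$ = continuous functions on $\Gamma^m$ affine on each simplex; $\mathbb V_0^m$ (resp. $\mathbb V_1^m$) = those vanishing on $\partial\Gamma^m$ (resp. on $\partial_1\Gamma^m$). $I_h^m:C(\Gamma^m)\to\mathbb V^m$ is the standard nodal interpolation operator. $\vec\mu_\partial^h$ is a given continuous piecewise affine vector field on $\partial_2\Gamma^m$ (trace of an element of $[\mathbb V^m]^d$). Inner products: $(f,g)_{\Gamma^m}$ is the $L^2$ inner product on $\Gamma^m$, $(\cdot,\cdot)_{\partial_2\Gamma^m}$ the one on $\partial_2\Gamma^m$, and the mass-lumped inner product is $(f,g)^h_{\Gamma^m}=\frac1d\sum_j\mathcal H^{d-1}(\sigma_j^m)\sum_{k=0}^{d-1}\lim_{\sigma_j^m\ni\vec x\to\vec q_{j_k}^m}f(\vec x)g(\vec x)$; both extend to vectors and matrices (with $A:B={\rm tr}(A^TB)$). Notation: $\nabla_s$ is the elementwise surface gradient, $(\nabla_s\vec\varphi)_{ij}$ the $j$-th component of $\nabla_s\varphi_i$, $\nabla_s\cdot\vec\varphi={\rm tr}\nabla_s\vec\varphi$, $\mathcal D(\vec\eta)=\nabla_s\vec\eta+(\nabla_s\vec\eta)^T$, $\vec{\rm id}$ the identity map on $\Gamma^m$. $\mathcal C_h^m(\overline{\varkappa}^m;\vec\eta^h)\in\mathbb V^m$ is defined by $(\mathcal C_h^m(\overline{\varkappa}^m;\vec\eta^h),\chi^h)^h_{\Gamma^m}=(\vec\eta^h\cdot\nabla_s\overline{\varkappa}^m,\chi^h)^h_{\Gamma^m}$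 for all $\chi^h\in\mathbb V^m$. The form $\mathcal B_h^m$ is $\mathcal B_h^m(\vec k,\overline{\varkappa}^m;\vec\eta)=(\nabla_s\vec k,\nabla_s\vec\eta)_{\Gamma^m}+\mathcal R_h^m(\vec\eta)$ with $$\begin{aligned}\mathcal R_h^m(\vec\eta)={}&(\nabla_s\cdot\vec k^m,\nabla_s\cdot\vec\eta)_{\Gamma^m}-((\nabla_s\vec k^m)^T,\mathcal D(\vec\eta)(\nabla_s\vec{\rm id})^T)^h_{\Gamma^m}\\&+((\vec k^m+\overline{\varkappa}^m\vec\nu^m)\cdot\vec k^m-\tfrac12|\vec k^m|^2,\nabla_s\vec{\rm id}:\nabla_s\vec\eta)^h_{\Gamma^m}\\&-(\overline{\varkappa}^m\vec k^m,(\nabla_s\vec\eta)^T\vec\nu^m)^h_{\Gamma^m}+(\mathcal C_h^m(\overline{\varkappa}^m;\vec\eta)\vec\nu^m,\vec k^m)^h_{\Gamma^m}.\end{aligned}$$ *)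

(* Defs.v *)
From HB Require Import structures.
From mathcomp Require Export all_boot all_order all_algebra.
From mathcomp Require Export perm.
From mathcomp Require Export all_classical all_reals all_analysis.
Set Implicit Arguments.
Unset Strict Implicit.
Unset Printing Implicit Defensive.
Import Order.TTheory GRing.Theory Num.Theory.
Import numFieldNormedType.Exports.
Local Open Scope classical_set_scope.
Local Open Scope ring_scope.

(* The ambient dimension is d = n.+2, so that simplices of the surface have
   n.+2 vertices and dimension n.+1, and their facets have n.+1 vertices and
   dimension n.  Vectors are columns. *)

(* A : B = tr (A^T B); on column vectors this is the Euclidean inner product.
   (The library norm `|_| on matrices is the sup norm, and is not used.) *)
Definition ip (R : realType) (p q : nat) (A B : 'M[R]_(p, q)) : R :=
  \tr (A^T *m B).

Definition enorm (R : realType) (p : nat) (v : 'cV[R]_p) : R :=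
  Num.sqrt (ip v v).

Section Simplex.
Variables (R : realType) (d : nat).
Local Notation point := 'cV[R]_d.

Definition edges (m : nat) (p : 'I_m.+1 -> point) : 'M[R]_(d, m) :=
  \matrix_(r, l) (p (lift ord0 l) - p ord0) r 0.

(* sqrt (det (E^T E)) is the Jacobian of the affine parametrization
   t |-> p_0 + E t of the simplex; it equals m! times its H^m measure. *)
Definition jacobian (m : nat) (p : 'I_m.+1 -> point) : R :=
  Num.sqrt (\det ((edges p)^T *m edges p)).

Definition simplex_measure (m : nat) (p : 'I_m.+1 -> point) : R :=
  jacobian p / (m`!)%:R.

(* Integral of f over {t in R^m | 0 < t_i, sum_i t_i < s}, as an iterated
   Lebesgue integral; for m = 0 it is the value at the only point. *)
Fixpoint corner_integral (m : nat) : R -> ('cV[R]_m -> R) -> R :=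
  match m with
  | 0 => fun _ f => f 0
  | m'.+1 => fun s f =>
      \int[@lebesgue_measure R]_(t in `]0, s[)
        corner_integral (s - t)
          (fun u : 'cV[R]_m' => f (col_mx (t%:M : 'cV[R]_1) u))
  end.

(* Integral of f with respect to H^m over the open simplex with vertices p. *)
Definition simplex_integral (m : nat) (p : 'I_m.+1 -> point)
    (f : point -> R) : R :=
  jacobian p * corner_integral 1 (fun t => f (p ord0 + edges p *m t)).

End Simplex.

(* Generalized wedge product of the d - 1 columns v_1, ..., v_(d-1) of V: the
   vector N with N . x = det (x, v_1, ..., v_(d-1)).  It is the cross product
   for d = 3 and the clockwise rotation by pi/2 for d = 2. *)
Definition wedge (R : realType) (n : nat) (V : 'M[R]_(n.+2, n.+1)) :
    'cV[R]_n.+2 :=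
  \col_r \det (row_mx (delta_mx r 0 : 'cV[R]_n.+2) V : 'M[R]_n.+2).

(* [elt j] lists the vertices of the j-th simplex in their given order.  The
   pair (j, i) stands for the facet of the j-th simplex opposite to its i-th
   vertex; [bd1], [bd2] are the sets of facets making up the two boundary
   parts; for d = 3 the closed parts may touch at vertices. *)
Record surface_data (R : realType) (n : nat) := SurfaceData {
  nV : nat;
  nT : nat;
  vtx : 'I_nV -> 'cV[R]_n.+2;
  elt : 'I_nT -> 'I_n.+2 -> 'I_nV;
  bd1 : {set 'I_nT * 'I_n.+2};
  bd2 : {set 'I_nT * 'I_n.+2}
}.

Section Surface.
Variables (R : realType) (n : nat) (G : surface_data R n).
Local Notation point := 'cV[R]_n.+2.

Definition hull (S : {set 'I_(nV G)}) : set point :=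
  [set x | exists t : 'I_(nV G) -> R,
     [/\ forall k, 0 <= t k, forall k, k \notin S -> t k = 0,
         \sum_k t k = 1 & x = \sum_k t k *: vtx k]].

Definition open_hull (S : {set 'I_(nV G)}) : set point :=
  [set x | exists t : 'I_(nV G) -> R,
     [/\ forall k, k \in S -> 0 < t k, forall k, k \notin S -> t k = 0,
         \sum_k t k = 1 & x = \sum_k t k *: vtx k]].

Definition elt_vertices (j : 'I_(nT G)) : {set 'I_(nV G)} :=
  [set elt j i | i : 'I_n.+2].

Definition facet_vertices (F : 'I_(nT G) * 'I_n.+2) : {set 'I_(nV G)} :=
  [set elt F.1 i | i : 'I_n.+2 & i != F.2].

Definition osimplex (j : 'I_(nT G)) : set point := open_hull (elt_vertices j).
Definition csimplex (j : 'I_(nT G)) : set point := hull (elt_vertices j).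

Definition Gamma : set point := \bigcup_j csimplex j.

Definition boundary_facets : {set 'I_(nT G) * 'I_n.+2} :=
  [set F | [forall j, (j != F.1) ==>
                        ~~ (facet_vertices F \subset elt_vertices j)]].

Definition facets_union (B : {set 'I_(nT G) * 'I_n.+2}) : set point :=
  [set x | exists2 F, F \in B & hull (facet_vertices F) x].

Definition dGamma : set point := facets_union boundary_facets.
Definition d1Gamma : set point := facets_union (bd1 G).
Definition d2Gamma : set point := facets_union (bd2 G).

(* Two simplices sharing a facet are consistently oriented iff they induce
   opposite orientations on it, i.e. iff every matching s of their positions
   that identifies the shared vertices (and the two remaining vertices) is
   odd.  In particular no facet can belong to three simplices. *)
Definition consistently_oriented : Prop :=
  forall (j j' : 'I_(nT G)) (i : 'I_n.+2) (s : 'S_n.+2), j != j' ->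
    (forall l, l != i -> elt j' (s l) = elt j l) -> odd_perm s.

(* Nondegeneracy of the simplices is not part of this definition. *)
Record polyhedral_surface : Prop := PolyhedralSurface {
  _ : injective (@vtx R n G);
  _ : forall j : 'I_(nT G), injective (elt j);
  _ : forall k : 'I_(nV G), exists j, k \in elt_vertices j;
  _ : forall j j' : 'I_(nT G), j != j' -> osimplex j `&` osimplex j' = set0;
  (* no hanging vertices: closed simplices meet in common faces *)
  _ : forall j j' : 'I_(nT G),
        csimplex j `&` csimplex j' `<=`
        hull (elt_vertices j :&: elt_vertices j');
  _ : consistently_oriented;
  _ : bd1 G :|: bd2 G = boundary_facets;
  _ : bd1 G :&: bd2 G = finset.set0
}.

Definition simplex_pts (j : 'I_(nT G)) (i : 'I_n.+2) : point := vtx (elt j i).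

Definition facet_pts (F : 'I_(nT G) * 'I_n.+2) (i : 'I_n.+1) : point :=
  vtx (elt F.1 (lift F.2 i)).

Definition area (j : 'I_(nT G)) : R := simplex_measure (simplex_pts j).

Definition nu (j : 'I_(nT G)) : point :=
  let N := wedge (edges (simplex_pts j)) in (enorm N)^-1 *: N.

Definition proj (j : 'I_(nT G)) : 'M[R]_n.+2 := 1%:M - nu j *m (nu j)^T.

Definition free_vertex (k : 'I_(nV G)) : Prop := ~ dGamma (vtx k).

(* Functions on Gamma are represented by functions on the whole space; only
   their values on Gamma matter, so two of them are identified when they agree
   on Gamma. *)
Definition Vh (f : point -> R) : Prop :=
  {within Gamma, continuous f} /\
  forall j, exists (g : point) (c : R),
    forall x, osimplex j x -> f x = ip g x + c.

Definition Vh0 (f : point -> R) : Prop :=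
  Vh f /\ forall x, dGamma x -> f x = 0.

Definition Vh1 (f : point -> R) : Prop :=
  Vh f /\ forall x, d1Gamma x -> f x = 0.

(* [V]^d *)
Definition vec (V : (point -> R) -> Prop) (f : point -> point) : Prop :=
  forall i, V (fun x => f x i 0).

(* The element of Vh with prescribed vertex values. *)
Definition nodal (a : 'I_(nV G) -> R) : point -> R :=
  get [set f | Vh f /\ forall k, f (vtx k) = a k].

Definition Ih (f : point -> R) : point -> R := nodal (fun k => f (vtx k)).

Definition vertex_normal_value (k : 'I_(nV G)) : point :=
  (\sum_(j | `[< csimplex j (vtx k) >]) area j)^-1 *:
    \sum_(j | `[< csimplex j (vtx k) >]) area j *: nu j.

Definition nu_hp (x : point) : point :=
  \col_i nodal (fun k => vertex_normal_value k i 0) x.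

(* Elementwise defined quantities are families indexed by the simplices, the
   j-th member being relevant on the j-th open simplex only. *)

Definition integral_Gamma (h : 'I_(nT G) -> point -> R) : R :=
  \sum_j simplex_integral (simplex_pts j) (h j).

Definition integral_d2Gamma (h : point -> R) : R :=
  \sum_(F in bd2 G) simplex_integral (facet_pts F) h.

(* Mass lumped integral: (f, g)^h is the lumped integral of f g. *)
Definition lumped (h : 'I_(nT G) -> point -> R) : R :=
  (n.+2%:R)^-1 * \sum_j area j *
    \sum_(i < n.+2)
      lim (h j x @[x --> within (osimplex j) (nbhs (simplex_pts j i))]).

(* Surface gradient: its l-th component is the derivative in the direction
   P e_l, which is tangential to the simplex. *)
Definition sgrad (f : point -> R) (j : 'I_(nT G)) (x : point) : point :=
  \col_l 'D_(proj j *m delta_mx l 0) f x.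

Definition sgradv (f : point -> point) (j : 'I_(nT G)) (x : point) :
    'M[R]_n.+2 :=
  \matrix_(i, l) sgrad (fun y => f y i 0) j x l 0.

Definition sdiv (f : point -> point) (j : 'I_(nT G)) (x : point) : R :=
  \tr (sgradv f j x).

Definition sdef (f : point -> point) (j : 'I_(nT G)) (x : point) :
    'M[R]_n.+2 :=
  sgradv f j x + (sgradv f j x)^T.

Definition grad_form (f g : point -> point) : R :=
  integral_Gamma (fun j x => ip (sgradv f j x) (sgradv g j x)).

Definition Ch (kappa : point -> R) (eta : point -> point) : point -> R :=
  get [set c | Vh c /\ forall chi, Vh chi ->
     lumped (fun j x => c x * chi x) =
     lumped (fun j x => ip (eta x) (sgrad kappa j x) * chi x)].

Definition Rh (km : point -> point) (kappa : point -> R)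
    (eta : point -> point) : R :=
  integral_Gamma (fun j x => sdiv km j x * sdiv eta j x)
  - lumped (fun j x => ip (sgradv km j x)^T
                          (sdef eta j x *m (sgradv id j x)^T))
  + lumped (fun j x =>
      (ip (km x + kappa x *: nu j) (km x) - 2^-1 * ip (km x) (km x))
      * ip (sgradv id j x) (sgradv eta j x))
  - lumped (fun j x => ip (kappa x *: km x) ((sgradv eta j x)^T *m nu j))
  + lumped (fun j x => ip (Ch kappa eta x *: nu j) (km x)).

(* B_h^m (k, kappa; eta); [km] is the given k^m entering R_h^m. *)
Definition Bh (km : point -> point) (k : point -> point)
    (kappa : point -> R) (eta : point -> point) : R :=
  grad_form k eta + Rh km kappa eta.

Definition theta_A (km : point -> point) (kappa : point -> R) : point -> R :=
  Ih (fun x => ip (km x) (nu_hp x) + kappa x).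

Record helfrich_solution (dt alpha : R) (km : point -> point)
    (kappa : point -> R) (mu : point -> point)
    (w k : point -> point) (lambda : point -> R) (p : point -> point)
    (lA lV : R) : Prop := HelfrichSolution {
  _ : vec Vh0 w;
  _ : vec Vh1 k;
  _ : Vh0 lambda;
  _ : vec Vh0 p;
  _ : forall chi, vec Vh0 chi ->
      0 = lumped (fun j x => ip (w x) (nu j) * ip (chi x) (nu j))
          - Bh km k kappa chi
          + lumped (fun j x => ip (proj j *m chi x) (p x))
          + alpha * grad_form chi p
          + lA * lumped (fun j x => ip (theta_A km kappa x *: nu j) (chi x))
          + lV * lumped (fun j x => ip (nu j) (chi x));
  _ : forall eta, vec Vh1 eta ->
      0 = lumped (fun j x => ip (k x + kappa x *: nu j) (eta x))
          + grad_form (fun x => x + dt *: w x) eta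
          - integral_d2Gamma (fun x => ip (mu x) (eta x));
  _ : forall rho, Vh0 rho ->
      0 = lumped (fun j x => ip (rho x *: nu j) (p x));
  _ : forall xi, vec Vh0 xi ->
      0 = lumped (fun j x => ip (proj j *m w x) (xi x))
          + lumped (fun j x => ip (lambda x *: nu j) (xi x))
          + alpha * grad_form w xi;
  _ : 0 = lumped (fun j x => ip (w x) (nu j));
  _ : 0 = lumped (fun j x => ip (theta_A km kappa x *: nu j) (w x))
}.

End Surface.

(* Main.v *)
Require Import Defs.
From mathcomp Require Import ring lra.
Set Implicit Arguments.
Unset Strict Implicit.
Unset Printing Implicit Defensive.
Import Order.TTheory GRing.Theory Num.Theory.
Import numFieldNormedType.Exports.
Local Open Scope classical_set_scope.
Local Open Scope ring_scope.

(** The scheme is a linear system in disguise, and it is square.  An element of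
    the finite element space is, on each closed simplex, the convex combination
    of its vertex values ([Vh_comb]), and all vertex values occur, because the
    affine pieces on two simplices agree on their common face
    ([Vh_interpolation]).  Every term of the six equations only sees these
    values: surface gradients are constant on each simplex ([sgrad_Vh]), the
    one-sided limits in a lumped product are vertex values ([lumpedE]), the
    remaining integrals over the surface have constant integrands
    ([simplex_integral_const]), the transport term is defined by a diagonal
    system ([Ch_Vh]), and the boundary data act as a linear functional of the
    vertex values ([boundary_functional]).  So the scheme is equivalent to a
    system for vertex values ([helfrich_discrete]) whose trial and test spaces
    coincide, and it suffices that the homogeneous system has only the trivial
    solution ([homogeneous_trivial], [nondegenerate_solvable]).

    For the homogeneous system, test the first equation with w, the second with
    k, the third with lambda and the fourth with p.  The multiplier terms drop
    out by the last two equations, the terms coupling w and p cancel, and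
      dt (w . nu, w . nu)^h + (k, k)^h = 0
    is left.  Hence k = 0 and w is orthogonal at each vertex to all adjacent
    normals.  The second equation, tested with w, now says that the surface
    gradient of w vanishes; as the surface is connected, w is a constant vector
    ([connected_constant]).  It is orthogonal to all vertex normals at free
    vertices, which span the space, so w = 0.  The fourth equation reduces to
    (lambda nu, xi)^h = 0, so lambda vanishes at each free vertex, the vertex
    normal there being nonzero.

    By the third equation p is orthogonal to the vertex normal at every free
    vertex, which removes the multiplier terms when the first equation is tested
    with p; what remains forces the tangential part of p to vanish on every
    simplex.  At a free vertex p is then parallel to all adjacent normals and
    orthogonal to their nonzero weighted sum, so p = 0 ([normal_parallel]).
    Finally lambda_A theta_A + lambda_V vanishes at each free vertex, and since
    theta_A takes two different values there, both multipliers are zero. *)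

(** * Inner products and solvability of bilinear systems *)

Section InnerProduct.
Variables (R : realType) (p q : nat).
Implicit Types A B C : 'M[R]_(p, q).

Lemma ipE A B : ip A B = \sum_i \sum_j A j i * B j i.
Proof.
rewrite /ip /mxtrace; apply: eq_bigr => i _; rewrite mxE.
by apply: eq_bigr => j _; rewrite mxE.
Qed.

Lemma ipC A B : ip A B = ip B A.
Proof. by rewrite /ip -mxtrace_tr trmx_mul trmxK. Qed.

Lemma ipDr A B C : ip A (B + C) = ip A B + ip A C.
Proof. by rewrite /ip mulmxDr mxtraceD. Qed.

Lemma ipZr A c B : ip A (c *: B) = c * ip A B.
Proof. by rewrite /ip -scalemxAr mxtraceZ. Qed.

Lemma ipDl A B C : ip (B + C) A = ip B A + ip C A.
Proof. by rewrite !(ipC _ A) ipDr. Qed.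

Lemma ipZl A c B : ip (c *: B) A = c * ip B A.
Proof. by rewrite !(ipC _ A) ipZr. Qed.

Lemma ip0r A : ip A 0 = 0.
Proof. by rewrite /ip mulmx0 mxtrace0. Qed.

Lemma ip0l A : ip 0 A = 0.
Proof. by rewrite ipC ip0r. Qed.

Lemma ipNr A B : ip A (- B) = - ip A B.
Proof. by rewrite -scaleN1r ipZr mulN1r. Qed.

Lemma ipBr A B C : ip A (B - C) = ip A B - ip A C.
Proof. by rewrite ipDr ipNr. Qed.

Lemma ipBl A B C : ip (B - C) A = ip B A - ip C A.
Proof. by rewrite !(ipC _ A) ipBr. Qed.

Lemma ip_sumr I (r : seq I) (P : pred I) A (F : I -> 'M[R]_(p, q)) :
  ip A (\sum_(i <- r | P i) F i) = \sum_(i <- r | P i) ip A (F i).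
Proof. by elim/big_rec2: _ => [|i x y _ <-]; rewrite ?ip0r ?ipDr. Qed.

Lemma ip_suml I (r : seq I) (P : pred I) A (F : I -> 'M[R]_(p, q)) :
  ip (\sum_(i <- r | P i) F i) A = \sum_(i <- r | P i) ip (F i) A.
Proof. by rewrite ipC ip_sumr; apply: eq_bigr => i _; rewrite ipC. Qed.

Lemma ip_ge0 A : 0 <= ip A A.
Proof.
rewrite ipE; apply: sumr_ge0 => i _; apply: sumr_ge0 => j _.
by rewrite -expr2 sqr_ge0.
Qed.

Lemma ip_eq0 A : (ip A A == 0) = (A == 0).
Proof.
apply/eqP/eqP => [|->]; last exact: ip0r.
rewrite ipE => /eqP; rewrite psumr_eq0; last first.
  by move=> i _; apply: sumr_ge0 => j _; rewrite -expr2 sqr_ge0.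
move=> /allP h; apply/matrixP => j i; rewrite mxE.
move: (h i); rewrite mem_index_enum => /(_ isT) /=.
rewrite psumr_eq0; last by move=> k _; rewrite -expr2 sqr_ge0.
move=> /allP /(_ j); rewrite mem_index_enum => /(_ isT) /=.
by rewrite -expr2 sqrf_eq0 => /eqP.
Qed.

Lemma ip_gt0 A : (0 < ip A A) = (A != 0).
Proof. by rewrite lt_neqAle ip_ge0 andbT eq_sym ip_eq0. Qed.

End InnerProduct.

Lemma ip_mulmxl (R : realType) p q r (A : 'M[R]_(p, q)) (B : 'M[R]_(q, r)) C :
  ip (A *m B) C = ip B (A^T *m C).
Proof. by rewrite /ip trmx_mul mulmxA. Qed.

Lemma ip_cV (R : realType) p (u v : 'cV[R]_p) : ip u v = \sum_i u i 0 * v i 0.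
Proof. by rewrite ipE big_ord1. Qed.

Lemma ip_scalar (R : realType) p (u v : 'cV[R]_p) : u^T *m v = (ip u v)%:M.
Proof. by rewrite [LHS]mx11_scalar /ip /mxtrace big_ord1. Qed.

Lemma ip_delta (R : realType) p (u : 'cV[R]_p) i : ip u (delta_mx i 0) = u i 0.
Proof.
rewrite ip_cV (bigD1 i) //= big1 ?addr0 ?mxE ?eqxx ?mulr1 // => j ji.
by rewrite mxE (negPf ji) mulr0.
Qed.

(** With one space for trial and test vectors, the matrix of [b] in a basis is
    square, so injectivity makes it invertible. *)
Lemma nondegenerate_solvable (R : fieldType) (X : vectType R)
    (b : X -> X -> R) (F : X -> R) :
  (forall v c u u', b (c *: u + u') v = c * b u v + b u' v) ->
  (forall u c v v', b u (c *: v + v') = c * b u v + b u v') ->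
  (forall c v v', F (c *: v + v') = c * F v + F v') ->
  (forall u, (forall v, b u v = 0) -> u = 0) ->
  exists u, forall v, b u v = F v.
Proof.
move=> bl br Fl nd.
have suml (I : finType) c (e : I -> X) v :
    b (\sum_i c i *: e i) v = \sum_i c i * b (e i) v.
  have b0 : b 0 v = 0.
    have := bl v (-1) 0 0; rewrite scaler0 addr0 => h.
    by rewrite h mulN1r addNr.
  elim/big_rec2: _ => [|i x y _ <-]; first by [].
  by rewrite bl.
have gsum (f : X -> R) : (forall c v v', f (c *: v + v') = c * f v + f v') ->
    forall (I : finType) c (e : I -> X), f (\sum_i c i *: e i) =
      \sum_i c i * f (e i).
  move=> fl I c e; have f0 : f 0 = 0.
    have := fl (-1) 0 0; rewrite scaler0 addr0 => h.
    by rewrite h mulN1r addNr.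
  by elim/big_rec2: _ => [|i x y _ <-]; rewrite ?fl.
pose e := vbasis {:X}.
have decomp v : v = \sum_i coord e i v *: e`_i.
  by apply: coord_vbasis; rewrite memvf.
pose M : 'M[R]_(\dim {:X}) := \matrix_(i, j) b e`_i e`_j.
have Mu : M \in unitmx.
  rewrite -row_free_unit; apply/row_freeP.
  have ker0 : kermx M = 0.
    apply/row_matrixP => i; rewrite row0.
    set c := row i _.
    have cM : c *m M = 0 by rewrite /c -row_mul mulmx_ker row0.
    have u0 : \sum_j c 0 j *: e`_j = 0.
      apply: nd => v; rewrite (decomp v) gsum // big1 // => k _.
      rewrite suml; move/rowP: cM => /(_ k); rewrite !mxE => cMk.
      rewrite (eq_bigr (fun j => c 0 j * M j k)) ?cMk ?mulr0 // => j _.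
      by rewrite !mxE.
    have fe : free e by apply: basis_free (vbasisP _).
    apply/rowP => j; rewrite [RHS]mxE.
    by move/freeP: fe => /(_ (fun j => c 0 j) u0 j).
  move/eqP: ker0; rewrite kermx_eq0 => /row_freeP [B hB].
  by exists B.
pose c := \row_j F e`_j *m invmx M.
exists (\sum_j c 0 j *: e`_j) => v.
rewrite (decomp v) gsum // gsum //; apply: eq_bigr => k _; congr (_ * _).
rewrite suml; transitivity ((c *m M) 0 k).
  by rewrite mxE; apply: eq_bigr => j _; rewrite !mxE.
by rewrite /c mulmxKV // mxE.
Qed.

(** * Geometry of one simplex *)

Section SimplexAlgebra.
Variables (R : realType) (n : nat).
Variable E : 'M[R]_(n.+2, n.+1).
Hypothesis Edet : 0 < \det (E^T *m E).

Let gramU : E^T *m E \in unitmx.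
Proof. by rewrite unitmxE unitfE gt_eqF. Qed.

Definition pinv : 'M[R]_(n.+1, n.+2) := invmx (E^T *m E) *m E^T.

Lemma pinvK : pinv *m E = 1%:M.
Proof. by rewrite /pinv -mulmxA mulVmx. Qed.

Let N := wedge E.

Lemma wedge_det x : ip N x = \det (row_mx x E : 'M[R]_n.+2).
Proof.
have col0 (y : 'cV[R]_n.+2) i : (row_mx y E : 'M[R]_n.+2) i 0 = y i 0.
  have -> : 0 = lshift n.+1 (0 : 'I_1) :> 'I_(1 + n.+1) by apply: val_inj.
  exact: row_mxEl.
rewrite ip_cV (expand_det_col _ 0).
apply: eq_bigr => i _; rewrite /N mxE mulrC col0; congr (_ * _).
rewrite (expand_det_col _ 0) (bigD1 i) //= big1 ?addr0; last first.
  by move=> k ki; rewrite col0 mxE (negPf ki) mul0r.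
rewrite col0 mxE !eqxx mul1r /cofactor; congr (_ * \det _).
apply/matrixP => a b; rewrite !mxE.
case: splitP => //= j jE; have := ltn_ord j.
by rewrite -jE.
Qed.

Lemma wedge_orth : E^T *m N = 0.
Proof.
apply/colP => l; rewrite [RHS]mxE.
have -> : (E^T *m N) l 0 = ip N (col l E).
  by rewrite mxE ip_cV; apply: eq_bigr => i _; rewrite !mxE mulrC.
rewrite wedge_det -det_tr.
apply: (@determinant_alternate _ _ _ (lshift n.+1 (0 : 'I_1)) (rshift 1 l)).
  by apply/eqP => /(congr1 val).
move=> i; rewrite [LHS]mxE [RHS]mxE.
apply: etrans (row_mxEl (col l E) E i 0) _; apply/esym.
by apply: etrans (row_mxEr (col l E) E i l) _; rewrite mxE.
Qed.

(** A nonzero [x] orthogonal to the columns of [E] satisfies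
    det (x | E) ^ 2 = |x| ^ 2 det (E^T E), so det (x | E), which is the inner
    product of the normal with [x], cannot vanish. *)
Lemma wedge_neq0 : N != 0.
Proof.
have : kermx E != 0.
  rewrite kermx_eq0 /row_free neq_ltn; apply/orP; left.
  by rewrite (leq_ltn_trans (rank_leq_col _)).
move=> /rowV0Pn [x xE x0]; move/sub_kermxP: xE => xE.
pose B : 'M[R]_(1 + n.+1) := row_mx x^T E.
apply/eqP => N0.
have detB : \det B = 0 by have := wedge_det x^T; rewrite N0 ip0l.
have := det_mulmx B^T B; rewrite detB mulr0.
have -> : B^T *m B = block_mx (x *m x^T) 0 0 (E^T *m E).
  rewrite tr_row_mx mul_col_row trmxK xE.
  by have -> : E^T *m x^T = 0 by rewrite -trmx_mul xE trmx0.
rewrite det_ublock => /eqP; rewrite mulf_eq0 (gt_eqF Edet) orbF.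
rewrite det_mx11 => /eqP xx0; move: x0.
rewrite -trmx_eq0 -ip_eq0 /ip /mxtrace big_ord1 trmxK xx0.
by rewrite eqxx.
Qed.

Definition unormal : 'cV[R]_n.+2 := (enorm N)^-1 *: N.

Lemma unormal_unit : ip unormal unormal = 1.
Proof.
rewrite /unormal ipZl ipZr mulrA -invfM -expr2 sqr_sqrtr ?ip_ge0 //.
by rewrite mulVf // ip_eq0 wedge_neq0.
Qed.

Lemma unormal_orth : E^T *m unormal = 0.
Proof. by rewrite /unormal -scalemxAr wedge_orth scaler0. Qed.

(** Both sides are the orthogonal projection onto the column space of [E]: they
    fix [E] and kill the normal, and these vectors together form a basis. *)
Lemma proj_pinv : 1%:M - unormal *m unormal^T = E *m pinv.
Proof.
set Q := _ - _.
have QE : Q *m E = E.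
  rewrite mulmxBl mul1mx -mulmxA.
  have -> : unormal^T *m E = 0.
    by rewrite -[E]trmxK -trmx_mul unormal_orth trmx0.
  by rewrite mulmx0 subr0.
have Qnu : Q *m unormal = 0.
  rewrite mulmxBl mul1mx -mulmxA ip_scalar unormal_unit mulmx1.
  by rewrite subrr.
pose B : 'M[R]_(n.+2, 1 + n.+1) := row_mx unormal E.
have BU : (B : 'M[R]_n.+2) \in unitmx.
  rewrite unitmxE unitfE -wedge_det /unormal ipZr mulf_neq0 ?ip_eq0 ?wedge_neq0 //.
  rewrite invr_neq0 // /enorm sqrtr_eq0 -ltNge ip_gt0.
  exact: wedge_neq0.
suff: Q *m B = (E *m pinv) *m B by move/(can_inj (@mulmxK _ n.+2 n.+2 B BU)).
have PE : E *m pinv *m E = E by rewrite -mulmxA pinvK mulmx1.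
have Pnu : E *m pinv *m unormal = 0.
  by rewrite -!mulmxA unormal_orth !mulmx0.
by rewrite /B !mul_mx_row QE Qnu PE Pnu.
Qed.

End SimplexAlgebra.

Lemma cvg_sum (R : realType) (T : Type) (F : set_system T) (I : Type)
    (r : seq I) (f : I -> T -> R) (a : I -> R) : Filter F ->
  (forall i, f i x @[x --> F] --> a i) ->
  \sum_(i <- r) f i x @[x --> F] --> \sum_(i <- r) a i.
Proof.
by move=> FF fa; apply: cvg_big => //; apply: add_continuous.
Qed.

(** * Barycentric coordinates and affine functions on a simplex *)

Section Points.
Variables (R : realType) (d : nat).

Lemma sum_supported (V : zmodType) m K (e : 'I_m -> 'I_K) (F : 'I_K -> V) :
  injective e -> (forall k, k \notin [set e i | i : 'I_m]%SET -> F k = 0) ->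
  \sum_k F k = \sum_i F (e i).
Proof.
move=> einj F0.
rewrite (bigID (mem [set e i | i : 'I_m]%SET)) /= [X in _ + X]big1 ?addr0 //.
by rewrite big_imset //= => i i' _ _; apply: einj.
Qed.

(** Barycentric coordinates of the point with coordinates [t] in the reference
    simplex; the zeroth one is what the others leave of 1. *)
Definition bcoord m (t : 'cV[R]_m) (i : 'I_m.+1) : R :=
  if unlift ord0 i is Some l then t l 0 else 1 - \sum_l t l 0.

Lemma sum_bcoord m (t : 'cV[R]_m) : \sum_i bcoord t i = 1.
Proof.
rewrite big_ord_recl {1}/bcoord unlift_none.
under [X in _ + X]eq_bigr do rewrite /bcoord liftK.
by rewrite subrK.
Qed.

Lemma bcoord_comb m (p : 'I_m.+1 -> 'cV[R]_d) (t : 'cV[R]_m) :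
  p ord0 + edges p *m t = \sum_i bcoord t i *: p i.
Proof.
rewrite big_ord_recl {1}/bcoord unlift_none.
under [X in _ = _ + X]eq_bigr do rewrite /bcoord liftK.
rewrite scalerBl scale1r -addrA; congr (_ + _).
rewrite scaler_suml -sumrN -big_split /=.
apply/colP => r; rewrite mxE summxE; apply: eq_bigr => l _.
by rewrite !mxE; ring.
Qed.

Lemma bcoord_lift m (s : 'I_m.+1 -> R) : \sum_i s i = 1 ->
  bcoord (\col_l s (lift ord0 l)) =1 s.
Proof.
move=> s1 i; rewrite /bcoord; case: unliftP => [l ->|->]; first by rewrite mxE.
rewrite -s1 big_ord_recl.
under [X in _ - X]eq_bigr do rewrite mxE.
by rewrite addrK.
Qed.

End Points.

Section Barycentric.
Variables (R : realType) (n : nat) (G : surface_data R n).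
Local Notation point := 'cV[R]_n.+2.
Local Notation K := (nV G).
Local Notation T := (nT G).

Lemma extend_coefficients m (e : 'I_m -> 'I_K) (s : 'I_m -> R) : injective e ->
  exists t : 'I_K -> R, (forall i, t (e i) = s i) /\
    forall k, k \notin [set e i | i : 'I_m]%SET -> t k = 0.
Proof.
move=> einj; exists (fun k => \sum_(i | e i == k) s i); split => [i|k kS].
  by rewrite (big_pred1 i) // => j /=; apply/eqP/eqP => [/einj|->].
rewrite big1 // => i /eqP ek; case/negP: kS.
by rewrite -ek imset_f.
Qed.

Lemma sum_coefficients m (e : 'I_m -> 'I_K) (s : 'I_m -> R) (t : 'I_K -> R) :
  injective e -> (forall i, t (e i) = s i) ->
  (forall k, k \notin [set e i | i : 'I_m]%SET -> t k = 0) ->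
  \sum_k t k = \sum_i s i /\ \sum_k t k *: vtx k = \sum_i s i *: vtx (e i).
Proof.
move=> einj te tS; split.
  by rewrite (sum_supported einj) //; apply: eq_bigr.
rewrite (sum_supported (F := fun k => t k *: vtx k) einj).
  by apply: eq_bigr => i _; rewrite te.
by move=> k /tS ->; rewrite scale0r.
Qed.

Lemma hull_local m (e : 'I_m -> 'I_K) (x : point) : injective e ->
  hull [set e i | i : 'I_m]%SET x <->
  exists s : 'I_m -> R, [/\ forall i, 0 <= s i, \sum_i s i = 1 &
     x = \sum_i s i *: vtx (e i)].
Proof.
move=> einj; split=> [[t [t0 tS t1 ->]]|[s [s0 s1 ->]]].
  have [ts tx] := sum_coefficients einj (fun=> erefl) tS.
  by exists (t \o e); split => // [i|]; [exact: t0|rewrite -t1 ts].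
have [t [te tS]] := extend_coefficients s einj.
have [ts tx] := sum_coefficients einj te tS.
exists t; split => //; last by rewrite ts.
move=> k; have [/imsetP [i _ ->]|/tS ->] := boolP (k \in [set e i | i : 'I_m]%SET) => //.
by rewrite te.
Qed.

Lemma open_hull_local m (e : 'I_m -> 'I_K) (x : point) : injective e ->
  open_hull [set e i | i : 'I_m]%SET x <->
  exists s : 'I_m -> R, [/\ forall i, 0 < s i, \sum_i s i = 1 &
     x = \sum_i s i *: vtx (e i)].
Proof.
move=> einj; split=> [[t [t0 tS t1 ->]]|[s [s0 s1 ->]]].
  have [ts tx] := sum_coefficients einj (fun=> erefl) tS.
  exists (t \o e); split => // [i|]; last by rewrite -t1 ts.
  by apply: t0; rewrite imset_f.
have [t [te tS]] := extend_coefficients s einj.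
have [ts tx] := sum_coefficients einj te tS.
exists t; split => //; last by rewrite ts.
by move=> k /imsetP [i _ ->]; rewrite te.
Qed.

Lemma hull_sub (S S' : {set 'I_K}) : S \subset S' -> hull S `<=` hull S'.
Proof.
move=> /fintype.subsetP SS x [t [t0 tS t1 ->]]; exists t; split => // k kS'.
by apply: tS; apply: contra kS'; apply: SS.
Qed.

Lemma hull_vtx (S : {set 'I_K}) k : k \in S -> hull S (vtx k).
Proof.
move=> kS; exists (fun l => (l == k)%:R); split.
- by move=> l; rewrite ler0n.
- by move=> l lS; case: eqP => // lk; rewrite -lk (negPf lS) in kS.
- by rewrite (bigD1 k) //= eqxx big1 ?addr0 // => l /negPf ->.
- rewrite (bigD1 k) //= eqxx scale1r big1 ?addr0 // => l /negPf ->.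
  by rewrite scale0r.
Qed.

Lemma open_hull_sub (S : {set 'I_K}) : open_hull S `<=` hull S.
Proof.
move=> x [t [t0 tS t1 ->]]; exists t; split => // k.
by case: (boolP (k \in S)) => [/t0/ltW|/tS ->].
Qed.

Hypothesis hG : polyhedral_surface G.
Hypothesis A1 : forall j : 'I_T, 0 < area j.

Local Notation E j := (edges (@simplex_pts R n G j)).

Lemma elt_inj (j : 'I_T) : injective (elt j).
Proof. by case: hG. Qed.

Lemma gram_gt0 (j : 'I_T) : 0 < \det ((E j)^T *m E j).
Proof.
have := A1 j; rewrite /area /simplex_measure /jacobian.
by rewrite pmulr_lgt0 ?invr_gt0 ?ltr0n ?fact_gt0 // sqrtr_gt0.
Qed.

Lemma nu_unit (j : 'I_T) : ip (nu j) (nu j) = 1.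
Proof. exact: unormal_unit (gram_gt0 j). Qed.

Lemma proj_nu (j : 'I_T) x : proj j *m x = x - ip (nu j) x *: nu j.
Proof.
rewrite /proj mulmxBl mul1mx -mulmxA ip_scalar; congr (_ - _).
by rewrite mul_mx_scalar.
Qed.

Lemma projE (j : 'I_T) : proj j = E j *m pinv (E j).
Proof. exact: proj_pinv (gram_gt0 j). Qed.

Lemma tr_proj (j : 'I_T) : (proj j)^T = proj j.
Proof. by rewrite /proj linearB /= trmx1 trmx_mul trmxK. Qed.

(** The tangential gradient of the affine function on the [j]-th simplex with
    vertex values [a]; transposing the left inverse of the edge matrix makes it
    tangential and linear in [a] at once. *)
Definition dgrad (j : 'I_T) (a : 'I_K -> R) : point :=
  (pinv (E j))^T *m \col_l (a (elt j (lift ord0 l)) - a (elt j ord0)).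

Definition aff (j : 'I_T) (a : 'I_K -> R) (x : point) : R :=
  a (elt j ord0) + ip (dgrad j a) (x - vtx (elt j ord0)).

Lemma aff_vtx (j : 'I_T) a i : aff j a (vtx (elt j i)) = a (elt j i).
Proof.
rewrite /aff; case: (unliftP ord0 i) => [l ->|->]; last first.
  by rewrite subrr ip0r addr0.
have -> : vtx (elt j (lift ord0 l)) - vtx (elt j ord0) = E j *m delta_mx l 0.
  rewrite -colE; apply/colP => r.
  by rewrite !mxE.
rewrite /dgrad ip_mulmxl trmxK mulmxA (pinvK (gram_gt0 j)) mul1mx.
by rewrite ip_delta mxE addrC subrK.
Qed.

Lemma affineE (f : point -> R) g c (s : 'I_K -> R) :
  (forall x, f x = c + ip g x) -> \sum_k s k = 1 ->
  f (\sum_k s k *: vtx k) = \sum_k s k * f (vtx k).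
Proof.
move=> fE s1; rewrite fE ip_sumr -[c in LHS]mul1r -s1 mulr_suml -big_split /=.
by apply: eq_bigr => k _; rewrite fE ipZr mulrDr.
Qed.

Lemma aff_comb (j : 'I_T) a (s : 'I_K -> R) :
  (forall k, k \notin elt_vertices j -> s k = 0) -> \sum_k s k = 1 ->
  aff j a (\sum_k s k *: vtx k) = \sum_k s k * a k.
Proof.
move=> sS s1.
rewrite (@affineE (aff j a) (dgrad j a)
  (a (elt j ord0) - ip (dgrad j a) (vtx (elt j ord0)))) //.
  apply: eq_bigr => k _; case: (boolP (k \in elt_vertices j)) => [|/sS ->].
    by case/imsetP => i _ ->; rewrite aff_vtx.
  by rewrite !mul0r.
by move=> x; rewrite /aff ipBr; ring.
Qed.

(** Apply the affine functions that are Kronecker deltas at the vertices. *)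
Lemma bary_unique (j : 'I_T) (s s' : 'I_K -> R) :
  (forall k, k \notin elt_vertices j -> s k = 0) -> \sum_k s k = 1 ->
  (forall k, k \notin elt_vertices j -> s' k = 0) -> \sum_k s' k = 1 ->
  \sum_k s k *: vtx k = \sum_k s' k *: vtx k -> s =1 s'.
Proof.
move=> h1 h2 h3 h4 h k.
have delta (t : 'I_K -> R) : \sum_l t l * (l == k)%:R = t k.
  rewrite (bigD1 k) //= eqxx mulr1 big1 ?addr0 // => l /negPf ->.
  by rewrite mulr0.
by rewrite -[s k]delta -[s' k]delta -!(@aff_comb j) // h.
Qed.

(** Closed simplices only meet in hulls of common vertices, and barycentric
    coordinates in the simplex that owns the vertex are unique. *)
Lemma vtx_in_csimplex (j : 'I_T) k : csimplex j (vtx k) <-> k \in elt_vertices j.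
Proof.
split; last exact: hull_vtx.
move=> kj; case: hG => _ _ cov _ meet _ _ _.
have [j' kj'] := cov k.
case: (meet j j' (vtx k)) => [|t [_ tS t1 kE]].
  by split => //; apply: hull_vtx.
apply/negPn/negP => nk.
have /(_ k) : t =1 (fun l => (l == k)%:R).
  apply: (@bary_unique j') => //.
  - by move=> l lj'; apply: tS; rewrite inE (negPf lj') andbF.
  - by move=> l lj'; case: eqP => // lk; rewrite lk kj' in lj'.
  - by rewrite (bigD1 k) //= eqxx big1 ?addr0 // => l /negPf ->.
  - rewrite -kE (bigD1 k) //= eqxx scale1r big1 ?addr0 // => l /negPf ->.
    by rewrite scale0r.
rewrite eqxx tS => [/esym/eqP|]; first by rewrite oner_eq0.
by rewrite inE (negPf nk).
Qed.

Lemma osimplex_local (j : 'I_T) x : osimplex j x <->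
  exists t : 'cV[R]_n.+1, [/\ forall i, 0 < bcoord t i &
    x = vtx (elt j ord0) + E j *m t].
Proof.
rewrite /osimplex /elt_vertices open_hull_local; last exact: elt_inj.
split=> [[s [s0 s1 ->]]|[t [t0 ->]]].
  exists (\col_l s (lift ord0 l)); split => [i|]; first by rewrite bcoord_lift.
  rewrite (bcoord_comb (simplex_pts j)); apply: eq_bigr => i _.
  by rewrite bcoord_lift.
exists (bcoord t); split => //; first by rewrite sum_bcoord.
exact: (bcoord_comb (simplex_pts j)).
Qed.

Lemma csimplex_local (j : 'I_T) x : csimplex j x <->
  exists t : 'cV[R]_n.+1, [/\ forall i, 0 <= bcoord t i &
    x = vtx (elt j ord0) + E j *m t].
Proof.
rewrite /csimplex /elt_vertices hull_local; last exact: elt_inj.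
split=> [[s [s0 s1 ->]]|[t [t0 ->]]].
  exists (\col_l s (lift ord0 l)); split => [i|]; first by rewrite bcoord_lift.
  rewrite (bcoord_comb (simplex_pts j)); apply: eq_bigr => i _.
  by rewrite bcoord_lift.
exists (bcoord t); split => //; first by rewrite sum_bcoord.
exact: (bcoord_comb (simplex_pts j)).
Qed.

Lemma continuous_ip (g : point) : continuous (fun x : point => ip g x).
Proof.
move=> x; under eq_fun do rewrite ip_cV.
apply: (@cvg_sum _ _ (nbhs x)) => i; apply: cvgM; first exact: cvg_cst.
exact: coord_continuous.
Qed.

Lemma continuous_aff (j : 'I_T) a : continuous (aff j a).
Proof.
have -> : aff j a = fun x => (a (elt j ord0) - ip (dgrad j a) (vtx (elt j ord0)))
    + ip (dgrad j a) x.
  by apply: funext => x; rewrite /aff ipBr; ring.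
by move=> x; apply: (@cvgD _ _ _ (nbhs x)); [exact: cvg_cst|exact: continuous_ip].
Qed.

End Barycentric.

(** * Continuous piecewise affine functions *)

Section PiecewiseAffine.
Variables (R : realType) (n : nat) (G : surface_data R n).
Local Notation point := 'cV[R]_n.+2.
Local Notation K := (nV G).
Local Notation T := (nT G).
Hypothesis hG : polyhedral_surface G.
Hypothesis A1 : forall j : 'I_T, 0 < area j.
Local Notation E j := (edges (@simplex_pts R n G j)).

Lemma osimplex_csimplex (j : 'I_T) : osimplex j `<=` csimplex j.
Proof. exact: open_hull_sub. Qed.

Lemma csimplex_Gamma (j : 'I_T) : csimplex j `<=` Gamma G.
Proof. by move=> x jx; exists j. Qed.

Lemma osimplex_Gamma (j : 'I_T) : osimplex j `<=` Gamma G.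
Proof. by move=> x /osimplex_csimplex/csimplex_Gamma. Qed.

Lemma csimplex_vtx (j : 'I_T) i : csimplex j (vtx (elt j i)).
Proof. by apply: hull_vtx; rewrite imset_f. Qed.

Lemma vtx_Gamma (k : 'I_K) : Gamma G (vtx k).
Proof.
case: hG => _ _ /(_ k) [j kj] _ _ _ _ _; exists j => //.
exact: hull_vtx.
Qed.

Lemma osimplex_nonempty (j : 'I_T) : osimplex j !=set0.
Proof.
pose s (i : 'I_n.+2) : R := (n.+2%:R)^-1.
exists (\sum_i s i *: vtx (elt j i)).
apply/open_hull_local; first exact: elt_inj hG j.
exists s; split => // [i|]; first by rewrite invr_gt0 ltr0n.
by rewrite /s sumr_const card_ord -[LHS]mulr_natr mulVf // pnatr_eq0.
Qed.

(** Moving towards an interior point approaches any point of the closed simplex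
    through the open one. *)
Lemma csimplex_segment (j : 'I_T) x : csimplex j x ->
  exists y : R -> point, y s @[s --> 0^'+] `=>` within (osimplex j) (nbhs x).
Proof.
move=> [t [t0 tS t1 xE]].
have [_ [b [b0 bS b1 _]]] := osimplex_nonempty j.
pose z := \sum_k b k *: vtx k.
pose y (s : R) := x + s *: (z - x).
have yx : y s @[s --> 0^'+] --> x.
  rewrite -[X in _ --> X]addr0 -[X in _ + X](scale0r (z - x)).
  apply: cvgD; first exact: cvg_cst.
  apply: cvgZr_tmp; apply: cvg_at_right_filter.
  exact: cvg_id.
exists y => U; rewrite /within /= => HU.
have := yx _ HU; rewrite /nbhs /= => {}HU.
near=> s.
have yU : osimplex j (y s) -> U (y s) by near: s.
apply: yU.
have s0 : 0 < s by near: s; exact: nbhs_right_gt.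
have s1 : s < 1 by near: s; exact: nbhs_right_lt.
exists (fun k => (1 - s) * t k + s * b k); split.
- move=> k kS; rewrite ltr_wpDl ?mulr_gt0 ?b0 // mulr_ge0 //; lra.
- by move=> k kS; rewrite tS // bS // !mulr0 addr0.
- by rewrite big_split /= -!mulr_sumr t1 b1; ring.
- rewrite /y xE /z; under [RHS]eq_bigr do rewrite scalerDl -!scalerA.
  rewrite big_split /= -!scaler_sumr scalerBl scale1r scalerBr.
  by rewrite addrA addrAC.
Unshelve. all: by end_near.
Qed.

Lemma within_osimplex_proper (j : 'I_T) x : csimplex j x ->
  ProperFilter (within (osimplex j) (nbhs x)).
Proof.
move=> /csimplex_segment [y hy]; split; last exact: within_filter.
by move=> /hy /= h; apply: (@filter_not_empty _ (0 : R)^'+).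
Qed.

Lemma Vh_within f x A : Vh G f -> Gamma G x -> A `<=` Gamma G ->
  f y @[y --> within A (nbhs x)] --> f x.
Proof.
move=> [/subspace_continuousP fc _] Gx AG.
apply: cvg_trans (fc x Gx) => U HU.
have {}HU : nbhs x [set y | Gamma G y -> U (f y)] := HU.
change (nbhs x [set y | A y -> U (f y)]).
by apply: filterS HU => y h /AG.
Qed.

(** The affine formula, given on the open simplex, extends to the closed one by
    continuity within the surface. *)
Lemma Vh_affine f (j : 'I_T) : Vh G f ->
  exists g c, forall x, csimplex j x -> f x = c + ip g x.
Proof.
move=> Vf; have [_ /(_ j) [g [c fE]]] := Vf.
exists g, c => x jx.
have := within_osimplex_proper jx => PF.
apply: (@norm_cvg_unique R R (f y @[y --> within (osimplex j) (nbhs x)])).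
  exact: Vh_within Vf (csimplex_Gamma jx) (@osimplex_Gamma j).
have h : (c + ip g y) @[y --> within (osimplex j) (nbhs x)] --> c + ip g x.
  apply: (@cvgD _ _ _ (within (osimplex j) (nbhs x))); first exact: cvg_cst.
  by apply: cvg_within_filter; exact: continuous_ip.
apply: cvg_trans h; apply: near_eq_cvg.
change (nbhs x [set y | osimplex j y -> c + ip g y = f y]).
by apply: filterE => y jy; rewrite fE // addrC.
Qed.

Lemma Vh_comb f (j : 'I_T) (s : 'I_K -> R) : Vh G f -> 
  (forall k, 0 <= s k) ->
  (forall k, k \notin elt_vertices j -> s k = 0) -> \sum_k s k = 1 ->
  f (\sum_k s k *: vtx k) = \sum_k s k * f (vtx k).
Proof.
move=> /(@Vh_affine _ j) [g [c fE]] s0 sS s1.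
rewrite fE; last by exists s.
rewrite (@affineE R n G (fun x => c + ip g x) g c s) //.
apply: eq_bigr => k _; case: (boolP (k \in elt_vertices j)) => [kj|/sS ->].
  by rewrite fE //; apply: hull_vtx.
by rewrite !mul0r.
Qed.

Lemma Vh_aff f (j : 'I_T) x : Vh G f -> csimplex j x ->
  f x = aff j (fun k : 'I_K => f (vtx k)) x.
Proof.
move=> Vf [s [s0 sS s1 ->]].
by rewrite (Vh_comb Vf s0 sS s1) aff_comb.
Qed.

Lemma Vh_eq f g : Vh G f -> Vh G g -> (forall k : 'I_K, f (vtx k) = g (vtx k)) ->
  {in Gamma G, f =1 g}.
Proof.
move=> Vf Vg fg x /set_mem [j _ jx].
rewrite (Vh_aff Vf jx) (Vh_aff Vg jx); congr aff.
exact: funext.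
Qed.

(** The affine pieces with prescribed vertex values fit together because two
    closed simplices meet in the hull of their common vertices, where both
    pieces are the same convex combination of vertex values. *)
Lemma aff_glue (j j' : 'I_T) a x : csimplex j x -> csimplex j' x ->
  aff j a x = aff j' a x.
Proof.
move=> jx j'x; case: hG => _ _ _ _ meet _ _ _.
have [|t [_ tS t1 ->]] := meet j j' x; first by split.
rewrite !aff_comb // => k kS; apply: tS.
  by apply: contra kS; rewrite inE => /andP [].
by apply: contra kS; rewrite inE => /andP [].
Qed.

(** A closed simplex consists of the points whose barycentric coordinates,
    computed with the left inverse of the edge matrix, are nonnegative and
    reproduce the point: finitely many closed conditions. *)
Lemma csimplex_closed (j : 'I_T) : closed (csimplex j).
Proof.
pose co (x : point) := pinv (E j) *m (x - vtx (elt j ord0)).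
have coK t : co (vtx (elt j ord0) + E j *m t) = t.
  by rewrite /co addrC addKr mulmxA (pinvK (gram_gt0 A1 j)) mul1mx.
have lin (g : point) c : continuous (fun x : point => c + ip g x).
  by move=> x; apply: (@cvgD _ _ _ (nbhs x)); [exact: cvg_cst|exact: continuous_ip].
pose bc i := fun x => bcoord (co x) i.
have coE l : exists g c, forall x, co x l 0 = c + ip g x.
  exists ((pinv (E j))^T *m delta_mx l 0),
         (- ip ((pinv (E j))^T *m delta_mx l 0) (vtx (elt j ord0))) => x.
  rewrite /co -ip_delta ipC -[pinv (E j)]trmxK -ip_mulmxl trmxK.
  by rewrite ipBr addrC.
have cco l : continuous (fun x => co x l 0).
  have [g [c h]] := coE l; rewrite (_ : (fun x => _) = (fun x => c + ip g x)).
    exact: lin.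
  exact: funext.
have cbc i : continuous (bc i).
  rewrite /bc /bcoord; case: unlift => [l|]; first exact: cco.
  move=> x; apply: (@cvgB _ _ _ (nbhs x)); first exact: cvg_cst.
  by apply: (@cvg_sum _ _ (nbhs x)) => l; apply: cco.
pose res (r : 'I_n.+2) x := (vtx (elt j ord0) + E j *m co x - x) r 0.
have cres r : continuous (res r).
  move=> x; rewrite /res.
  have -> : (fun x => (vtx (elt j ord0) + E j *m co x - x) r 0) =
     (fun x => (vtx (elt j ord0) r 0 + \sum_l E j r l * co x l 0) - x r 0).
    by apply: funext => y; rewrite !mxE.
  apply: (@cvgB _ _ _ (nbhs x)); last exact: coord_continuous.
  apply: (@cvgD _ _ _ (nbhs x)); first exact: cvg_cst.
  apply: (@cvg_sum _ _ (nbhs x)) => l.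
  by apply: cvgM; [exact: cvg_cst|exact: cco].
have -> : csimplex j = (\bigcap_i (bc i @^-1` [set y | 0 <= y])) `&`
                       (\bigcap_r (res r @^-1` [set 0])).
  apply/seteqP; split => x.
    move=> /(csimplex_local hG) [t [t0 ->]]; split => [i _|r _] /=.
      by rewrite /bc coK.
    by rewrite /res coK subrr mxE.
  move=> [h1 h2]; apply/(csimplex_local hG); exists (co x); split.
    by move=> i; apply: h1.
  apply/eqP; rewrite eq_sym -subr_eq0; apply/eqP/colP => r.
  by rewrite [RHS]mxE; exact: h2 r I.
apply: closedI; apply: closed_bigI => i _.
  by apply: closed_comp; [move=> x _; exact: cbc|exact: closed_ge].
by apply: closed_comp; [move=> x _; exact: cres|exact: closed_eq].
Qed.

Lemma Vh_interpolation (a : 'I_K -> R) :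
  exists f, Vh G f /\ forall k : 'I_K, f (vtx k) = a k.
Proof.
pose f x := if pselect (exists j : 'I_T, csimplex j x) is left h
            then aff (projT1 (cid h)) a x else 0.
have fE j x : csimplex j x -> f x = aff j a x.
  move=> jx; rewrite /f; case: pselect => [h|]; last by case; exists j.
  by apply: aff_glue (projT2 (cid h)) jx.
exists f; split; first split.
- have -> : Gamma G = \big[setU/set0]_(j : 'I_T) csimplex j.
    rewrite -bigcup_seq; apply: eq_bigcupl; split => j //= _.
    by rewrite mem_index_enum.
  apply: (@proj2 (closed (\big[setU/set0]_(j : 'I_T) csimplex j))).
  elim/big_rec: _ => [|j A _ [cA fA]].
    by split; [exact: closed0|exact: continuous_subspace0].
  split; first by apply: closedU => //; exact: csimplex_closed.
  apply: withinU_continuous => //; first exact: csimplex_closed.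
  apply/subspace_continuousP => x jx.
  have h : aff j a y @[y --> within (csimplex j) (nbhs x)] --> f x.
    by rewrite (fE _ _ jx); apply: cvg_within_filter; exact: continuous_aff.
  apply: cvg_trans h; apply: near_eq_cvg.
  change (nbhs x [set y | csimplex j y -> aff j a y = f y]).
  by apply: filterE => y /fE.
- move=> j; exists (dgrad j a), (a (elt j ord0) - ip (dgrad j a) (vtx (elt j ord0))).
  by move=> x /osimplex_csimplex /fE ->; rewrite /aff ipBr; ring.
- move=> k; case: hG => _ _ /(_ k) [j kj] _ _ _ _ _.
  rewrite (fE j); last exact: hull_vtx.
  by case/imsetP: kj => i _ ->; rewrite aff_vtx.
Qed.

Lemma nodalP (a : 'I_K -> R) :
  Vh G (@nodal R n G a) /\ forall k : 'I_K, @nodal R n G a (vtx k) = a k.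
Proof. exact: getPex (Vh_interpolation a). Qed.

End PiecewiseAffine.

(** * Iterated integrals over the reference simplex *)

Section CornerIntegral.
Variable R : realType.
Local Notation leb := (@lebesgue_measure R).

Lemma continuous_integrable (a b : R) (f : R -> R) : continuous f ->
  leb.-integrable `[a, b] (EFin \o f).
Proof.
move=> fc; apply: (@continuous_compact_integrable R f `[a, b]).
  exact: segment_compact.
exact: continuous_subspaceT.
Qed.

Lemma continuous_integrable_oo (f : R -> R) (a b : R) : continuous f ->
  leb.-integrable `]a, b[ (EFin \o f).
Proof.
move=> fc; apply: (integrableS _ _ _ (continuous_integrable a b fc)) => //.
exact: subset_itv_oo_cc.
Qed.

Lemma Rintegral_oo_FTC2 (a b : R) (f F : R -> R) : a < b ->
  continuous f -> (forall x : R, is_derive x (1 : R) F (f x)) ->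
  \int[leb]_(x in `]a, b[) f x = F b - F a.
Proof.
move=> ab fc FD.
have Fc : continuous F.
  move=> x; apply: differentiable_continuous; apply/derivable1_diffP.
  by have [] := FD x.
rewrite Rintegral_itv_bndo_bndc; last exact: continuous_integrable_oo.
rewrite Rintegral_itv_obnd_cbnd; last first.
  apply: (integrableS _ _ _ (continuous_integrable a b fc)) => //.
  exact: subset_itv_oc_cc.
rewrite /Rintegral (@continuous_FTC2 _ f F) //.
- exact: continuous_subspaceT.
- split.
  + by move=> x _; have [] := FD x.
  + by apply: cvg_at_right_filter; exact: Fc.
  + by apply: cvg_at_left_filter; exact: Fc.
- move=> x _; rewrite derive1E; have := FD x => h.
  by rewrite derive_val.
Qed.

Lemma integral_power (s c : R) m : 0 < s ->
  \int[leb]_(t in `]0, s[) (c * (s - t) ^+ m / m`!%:R) =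
  c * s ^+ m.+1 / m.+1`!%:R.
Proof.
move=> s0.
pose F (t : R) := - (c / m.+1`!%:R) * (s - t) ^+ m.+1.
have FD (x : R) : is_derive x (1 : R) F (c * (s - x) ^+ m / m`!%:R).
  have -> : F = - (c / m.+1`!%:R) \*: ((cst s - id) ^+ m.+1 : R -> R).
    apply: funext => t; rewrite /F /=; congr (_ * _).
    by elim: (m.+1) => [|k IHk]; rewrite ?expr0 ?exprS // IHk.
  apply: is_derive_eq; rewrite factS natrM sub0r /GRing.scale /=.
  have m0 : m`!%:R != 0 :> R by rewrite pnatr_eq0 -lt0n fact_gt0.
  have m1 : m.+1%:R != 0 :> R by rewrite pnatr_eq0.
  rewrite !fctE /cst /=; field.
  by rewrite m0 addrC natr1 m1.
rewrite (Rintegral_oo_FTC2 s0 _ FD).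
  by rewrite /F subrr subr0 expr0n /= mulr0 sub0r mulNr opprK mulrAC.
move=> x; apply: cvgM; last exact: cvg_cst.
apply: cvgM; first exact: cvg_cst.
apply: (@cvg_comp _ _ _ (fun t => s - t) (fun x => x ^+ m)).
  by apply: cvgB; [exact: cvg_cst|exact: cvg_id].
exact: exprn_continuous.
Qed.

Lemma corner_integral_const m (s c : R) (f : 'cV[R]_m -> R) : 0 < s ->
  (forall t : 'cV[R]_m, (forall l, 0 < t l 0) -> \sum_l t l 0 < s -> f t = c) ->
  corner_integral s f = c * s ^+ m / m`!%:R.
Proof.
elim: m s f => [|m IH] s f s0 fE /=.
  rewrite fE ?expr0 ?fact0 ?mulr1 ?divr1 //; first by case.
  by rewrite big_ord0.
rewrite -integral_power //; apply: eq_Rintegral => t.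
rewrite inE /= in_itv /= => /andP [t0 ts].
apply: IH => [|u u0 us]; first by rewrite subr_gt0.
apply: fE => [l|].
  by rewrite mxE; case: splitP => k _ //; rewrite mxE (ord1 k) eqxx mulr1n.
suff : \sum_(l < 1 + m) (col_mx (t%:M : 'cV[R]_1) u) l 0 < s by [].
rewrite big_split_ord /= big_ord1 col_mxEu mxE eqxx mulr1n.
by under eq_bigr do rewrite col_mxEd; rewrite -ltrBrDl.
Qed.

(** Boundary facets are points or segments.  In these dimensions every integrand
    is a function of the sum of the coordinates, and linearity is that of the
    integral of continuous functions over an interval. *)
Lemma corner_integral_comb n (I : finType) (a : I -> R)
    (g : I -> 'cV[R]_n -> R) (f : 'cV[R]_n -> R) : (n <= 1)%N ->
  (forall i, exists P : R -> R, continuous P /\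
     forall t : 'cV[R]_n, g i t = P (\sum_l t l 0)) ->
  (forall t : 'cV[R]_n, (forall l, 0 < t l 0) -> \sum_l t l 0 < 1 ->
     f t = \sum_i a i * g i t) ->
  corner_integral 1 f = \sum_i a i * corner_integral 1 (g i).
Proof.
case: n g f => [|[|//]] g f _ gc fE /=.
  by apply: fE; [case|rewrite big_ord0].
pose h i (t : R) := g i (col_mx (t%:M : 'cV[R]_1) 0).
have sumt (t : R) : \sum_l (col_mx (t%:M : 'cV[R]_1) (0 : 'cV_0)) l 0 = t.
  rewrite (@big_split_ord _ _ _ 1 0) /= big_ord0 addr0 big_ord1.
  by rewrite col_mxEu mxE mulr1n.
have hc i : continuous (h i).
  have [P [Pc gP]] := gc i.
  rewrite (_ : h i = P) //; apply: funext => t.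
  by rewrite /h gP sumt.
have sumc (r : seq I) : continuous (fun t => \sum_(i <- r) a i * h i t).
  move=> t; apply: (@cvg_sum _ _ (nbhs t)) => i.
  by apply: cvgM; [exact: cvg_cst|exact: hc].
transitivity (\int[leb]_(t in `]0, 1[) \sum_i a i * h i t).
  apply: eq_Rintegral => t; rewrite inE /= in_itv /= => /andP [t0 t1].
  apply: fE => [l|]; last by move: t1; rewrite -{1}(sumt t).
  rewrite mxE; case: splitP => [k _|[]//].
  by rewrite mxE (ord1 k) eqxx mulr1n.
elim: (index_enum I) => [|i r IHr].
  rewrite big_nil (@eq_Rintegral _ _ _ _ _ (fun=> 0 * 0)) => [|t _].
    rewrite RintegralZl ?mul0r //.
    by apply: (@continuous_integrable_oo (fun=> 0)) => t; exact: cvg_cst.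
  by rewrite big_nil mul0r.
rewrite big_cons -{}IHr -RintegralZl //; last exact: continuous_integrable_oo (hc i).
rewrite -RintegralD //; first by apply: eq_Rintegral => t _; rewrite big_cons.
  apply: continuous_integrable_oo => t.
  by apply: cvgM; [exact: cvg_cst|exact: hc].
exact: continuous_integrable_oo (sumc r).
Qed.

End CornerIntegral.

(** * Integrals over the surface and its boundary *)

Section SurfaceIntegrals.
Variables (R : realType) (n : nat) (G : surface_data R n).
Local Notation point := 'cV[R]_n.+2.
Local Notation K := (nV G).
Local Notation T := (nT G).
Hypothesis hG : polyhedral_surface G.
Hypothesis A1 : forall j : 'I_T, 0 < area j.

Lemma bcoord_gt0 m (t : 'cV[R]_m) : (forall l, 0 < t l 0) ->
  \sum_l t l 0 < 1 -> forall i, 0 < bcoord t i.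
Proof.
move=> t0 t1 i; rewrite /bcoord; case: unlift => [l|]; first exact: t0.
by rewrite subr_gt0.
Qed.

Lemma simplex_integral_const (j : 'I_T) h c :
  (forall x, osimplex j x -> h x = c) ->
  simplex_integral (@simplex_pts R n G j) h = area j * c.
Proof.
move=> hc; rewrite /simplex_integral (@corner_integral_const _ _ _ c) //.
  by rewrite expr1n mulr1 /area /simplex_measure mulrA mulrAC.
move=> t t0 t1; apply: hc; apply/(osimplex_local hG).
by exists t; split => //; apply: bcoord_gt0.
Qed.

Lemma integral_Gamma_const h (c : 'I_T -> R) :
  (forall j x, osimplex j x -> h j x = c j) ->
  integral_Gamma h = \sum_j area j * c j.
Proof.
by move=> hc; apply: eq_bigr => j _; apply: simplex_integral_const; apply: hc.
Qed.

(** Data and test field are both combinations of their vertex values with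
    barycentric weights, so the integral is bilinear in these values with the
    mass matrix of the facet as coefficients. *)
Lemma facet_functional (F : 'I_T * 'I_n.+2) (mu M : point -> point) :
  (n <= 1)%N -> F \in bd2 G -> vec (@Vh R n G) M -> {in d2Gamma G, mu =1 M} ->
  exists c : 'I_n.+1 -> point, forall eta, vec (@Vh R n G) eta ->
    simplex_integral (facet_pts F) (fun x => ip (mu x) (eta x)) =
    \sum_i ip (c i) (eta (facet_pts F i)).
Proof.
move=> n1 F2 VM muM.
pose W (il : 'I_n.+1 * 'I_n.+1) (t : 'cV[R]_n) := bcoord t il.1 * bcoord t il.2.
pose w il := jacobian (facet_pts F) * corner_integral 1 (W il).
exists (fun i => \sum_l w (i, l) *: M (facet_pts F l)) => eta Veta.
pose e i := elt F.1 (lift F.2 i).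
have einj : injective e by move=> i i' /(elt_inj hG)/lift_inj.
have eF : [set e i | i : 'I_n.+1]%SET = facet_vertices F.
  apply/setP => k; apply/imsetP/imsetP => [[i _ ->]|[i iF ->]].
    by exists (lift F.2 i) => //; rewrite inE eq_sym neq_lift.
  have : i != F.2 by move: iF; rewrite inE.
  case: (unliftP F.2 i) => [l -> _|->]; last by rewrite eqxx.
  by exists l.
have fsub : facet_vertices F \subset elt_vertices F.1.
  by apply/fintype.subsetP => k /imsetP [i _ ->]; apply: imset_f.
have comb f (t : 'cV[R]_n) : vec (@Vh R n G) f ->
    (forall l, 0 < t l 0) -> \sum_l t l 0 < 1 ->
    let x := facet_pts F ord0 + edges (facet_pts F) *m t in
    d2Gamma G x /\ f x = \sum_i bcoord t i *: f (facet_pts F i).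
  move=> Vf t0 t1 x.
  have hx : hull (facet_vertices F) x.
    rewrite -eF; apply/hull_local => //; exists (bcoord t); split.
    - by move=> i; apply/ltW/bcoord_gt0.
    - exact: sum_bcoord.
    - by rewrite /x bcoord_comb.
  split; first by exists F.
  have [g [c gE]] : exists g c, forall i x, csimplex F.1 x -> f x i 0 = c i + ip (g i) x.
    have h i := Vh_affine hG F.1 (Vf i).
    exists (fun i => projT1 (cid (h i))).
    exists (fun i => projT1 (cid (projT2 (cid (h i))))) => i.
    exact: (projT2 (cid (projT2 (cid (h i))))).
  apply/colP => r; rewrite gE; last exact: hull_sub fsub _ hx.
  rewrite summxE /x bcoord_comb ip_sumr -[c r]mul1r -(sum_bcoord t).
  rewrite mulr_suml -big_split /=; apply: eq_bigr => i _.
  rewrite mxE gE ?ipZr ?mulrDr //.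
  by apply: hull_vtx; rewrite imset_f.
rewrite /simplex_integral.
pose a (il : 'I_n.+1 * 'I_n.+1) := ip (M (facet_pts F il.2)) (eta (facet_pts F il.1)).
rewrite (@corner_integral_comb R n _ a W) //.
- rewrite mulr_sumr.
  under [RHS]eq_bigr do rewrite ip_suml.
  rewrite pair_bigA /=; apply: eq_bigr => -[i l] _ /=.
  by rewrite ipZl /w /a /=; ring.
- move=> [i l]; rewrite /W /=.
  have bc (i' : 'I_n.+1) : exists P : R -> R, continuous P /\
      forall t : 'cV[R]_n, bcoord t i' = P (\sum_l t l 0).
    rewrite /bcoord; case: unlift => [k|]; last first.
      exists (fun x => 1 - x); split => // x.
      by apply: cvgB; [exact: cvg_cst|exact: cvg_id].
    exists id; split => [x|t]; first exact: cvg_id.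
    move: k t; clear -n1; case: n n1 => [|[|//]] _ k t; first by case: k.
    by rewrite big_ord1 (ord1 k).
  have [P [Pc PE]] := bc i; have [Q [Qc QE]] := bc l.
  exists (fun x => P x * Q x); split => [x|t]; last by rewrite PE QE.
  by apply: cvgM; [exact: Pc|exact: Qc].
- move=> t t0 t1.
  have [d2 ->] := comb eta t Veta t0 t1; rewrite muM; last exact: mem_set.
  have [_ ->] := comb M t VM t0 t1.
  rewrite ip_sumr; under eq_bigr do rewrite ip_suml.
  rewrite pair_bigA /=; apply: eq_bigr => -[i l] _ /=.
  by rewrite ipZr ipZl /W /a /=; ring.
Qed.

Lemma boundary_functional (mu M : point -> point) :
  (n <= 1)%N -> vec (@Vh R n G) M -> {in d2Gamma G, mu =1 M} ->
  exists c : 'I_K -> point, forall eta, vec (@Vh R n G) eta ->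
    integral_d2Gamma G (fun x => ip (mu x) (eta x)) =
    \sum_k ip (c k) (eta (vtx k)).
Proof.
move=> n1 VM muM.
have h F : exists c : 'I_n.+1 -> point, F \in bd2 G ->
    forall eta, vec (@Vh R n G) eta ->
    simplex_integral (facet_pts F) (fun x => ip (mu x) (eta x)) =
    \sum_i ip (c i) (eta (facet_pts F i)).
  case: (boolP (F \in bd2 G)) => [F2|_]; last by exists (fun=> 0).
  by have [c cE] := facet_functional n1 F2 VM muM; exists c.
pose c F := projT1 (cid (h F)).
exists (fun k => \sum_(F in bd2 G) \sum_(i | elt F.1 (lift F.2 i) == k) c F i).
move=> eta Veta; rewrite /integral_d2Gamma.
under [RHS]eq_bigr do rewrite ip_suml.
rewrite exchange_big /=; apply: eq_bigr => F F2.
rewrite (projT2 (cid (h F)) F2 _ Veta) -/(c F).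
under [RHS]eq_bigr do rewrite ip_suml.
rewrite [RHS](exchange_big_dep xpredT) //=; apply: eq_bigr => i _.
by rewrite (big_pred1 (elt F.1 (lift F.2 i))).
Qed.

End SurfaceIntegrals.

(** * Surface gradients and lumped integrals in terms of vertex values *)

Section EntrywiseConvergence.
Variables (R : realType) (X : Type) (F : set_system X).
Hypothesis FF : Filter F.

(** Stating limits of matrices entry by entry reduces them to real limits. *)
Definition ecvg p q (A : X -> 'M[R]_(p, q)) (a : 'M[R]_(p, q)) :=
  forall i j, A x i j @[x --> F] --> a i j.

Lemma ecvg_cst p q (a : 'M[R]_(p, q)) : ecvg (fun=> a) a.
Proof. by move=> i j; exact: cvg_cst. Qed.

Lemma ecvgD p q (A B : X -> 'M[R]_(p, q)) a b : ecvg A a -> ecvg B b ->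
  ecvg (fun x => A x + B x) (a + b).
Proof.
move=> hA hB i j; rewrite mxE; under eq_fun do rewrite mxE.
by apply: cvgD.
Qed.

Lemma ecvgZ p q (c : X -> R) (A : X -> 'M[R]_(p, q)) (k : R) a :
  c x @[x --> F] --> k -> ecvg A a -> ecvg (fun x => c x *: A x) (k *: a).
Proof.
move=> hc hA i j; rewrite mxE; under eq_fun do rewrite mxE.
by apply: cvgM.
Qed.

Lemma ecvgM p q r (A : X -> 'M[R]_(p, q)) (B : X -> 'M[R]_(q, r)) a b :
  ecvg A a -> ecvg B b -> ecvg (fun x => A x *m B x) (a *m b).
Proof.
move=> hA hB i j; rewrite mxE; under eq_fun do rewrite mxE.
by apply: cvg_sum => l; apply: cvgM.
Qed.

Lemma cvg_ip p q (A B : X -> 'M[R]_(p, q)) a b : ecvg A a -> ecvg B b ->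
  ip (A x) (B x) @[x --> F] --> ip a b.
Proof.
move=> hA hB; rewrite ipE; under eq_fun do rewrite ipE.
by apply: cvg_sum => i; apply: cvg_sum => j; apply: cvgM.
Qed.

End EntrywiseConvergence.

Section VertexValues.
Variables (R : realType) (n : nat) (G : surface_data R n).
Local Notation point := 'cV[R]_n.+2.
Local Notation K := (nV G).
Local Notation T := (nT G).
Hypothesis hG : polyhedral_surface G.
Hypothesis A1 : forall j : 'I_T, 0 < area j.
Local Notation E j := (edges (@simplex_pts R n G j)).

Local Notation nval f := (fun k : 'I_K => f (vtx k)).

Lemma proj_dgrad (j : 'I_T) a : proj j *m dgrad j a = dgrad j a.
Proof.
rewrite -tr_proj (projE A1) trmx_mul /dgrad mulmxA -(mulmxA _ (E j)^T).
by rewrite -trmx_mul (pinvK (gram_gt0 A1 j)) trmx1 mulmx1.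
Qed.

(** Near an interior point of a simplex, moving tangentially stays inside, so
    the difference quotients only see the affine piece. *)
Lemma sgrad_Vh f (j : 'I_T) x : Vh G f -> osimplex j x ->
  sgrad f j x = dgrad j (nval f).
Proof.
move=> Vf jx; apply/colP => l; rewrite mxE.
rewrite -[RHS]ip_delta -[dgrad _ _]proj_dgrad ip_mulmxl tr_proj.
set v := proj j *m delta_mx l 0.
have [t [t0 xE]] := (osimplex_local hG j x).1 jx.
have [u vE] : exists u : 'cV[R]_n.+1, v = E j *m u.
  by exists (pinv (E j) *m delta_mx l 0); rewrite /v (projE A1) -mulmxA.
pose d i : R := if unlift ord0 i is Some k then u k 0 else - \sum_k u k 0.
have bE (h : R) i : bcoord (t + h *: u) i = bcoord t i + h * d i.
  rewrite /bcoord /d; case: unlift => [k|]; first by rewrite !mxE.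
  under eq_bigr do rewrite !mxE.
  by rewrite big_split /= -mulr_sumr; ring.
have near0 : \forall h \near (0 : R)^', osimplex j (h *: v + x).
  apply: nbhs_dnbhs.
  have : \forall h \near (0 : R), forall i, 0 < bcoord t i + h * d i.
    apply: (@filter_forall _ _ (fun i h => 0 < bcoord t i + h * d i) (nbhs (0 : R))) => i.
    have c : bcoord t i + h * d i @[h --> (0 : R)] --> bcoord t i + 0 * d i.
      apply: (@cvgD _ _ _ (nbhs (0 : R))); first exact: cvg_cst.
      by apply: (@cvgM _ _ (nbhs (0 : R))); [exact: cvg_id|exact: cvg_cst].
    by apply: (cvgr_gt _ c); rewrite mul0r addr0.
  apply: filterS => h hb; apply/(osimplex_local hG).
  exists (t + h *: u); split => [i|]; first by rewrite bE.
  by rewrite xE vE mulmxDr scalemxAr [RHS]addrA addrC.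
rewrite /derive; apply: cvg_lim => //.
have c : ip (dgrad j (nval f)) v @[h --> (0 : R)^'] --> ip (dgrad j (nval f)) v.
  exact: cvg_cst.
apply: cvg_trans c; apply: near_eq_cvg.
near=> h.
have h0 : h != 0 by near: h; exact: nbhs_dnbhs_neq.
have jh : osimplex j (h *: v + x) by near: h.
rewrite /= (Vh_aff hG A1 Vf (osimplex_csimplex jh)).
rewrite (Vh_aff hG A1 Vf (osimplex_csimplex jx)) /aff.
rewrite -addrA !ipDr ipZr /GRing.scale /=.
by field.
Unshelve. all: by end_near.
Qed.

Definition dgradv (j : 'I_T) (a : 'I_K -> point) : 'M[R]_n.+2 :=
  \matrix_(i, l) dgrad j (fun k => a k i 0) l 0.

Lemma sgradv_Vh f (j : 'I_T) x : vec (@Vh R n G) f -> osimplex j x ->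
  sgradv f j x = dgradv j (nval f).
Proof.
by move=> Vf jx; apply/matrixP => i l; rewrite mxE [RHS]mxE (sgrad_Vh (Vf i) jx).
Qed.

Definition stiff (a b : 'I_K -> point) : R :=
  \sum_j area j * ip (dgradv j a) (dgradv j b).

(** Both gradients are constant on a simplex, so integration multiplies by the
    area. *)
Lemma grad_formE f g : vec (@Vh R n G) f -> vec (@Vh R n G) g ->
  grad_form G f g = stiff (nval f) (nval g).
Proof.
move=> Vf Vg; apply: integral_Gamma_const => // j x jx.
by rewrite !sgradv_Vh.
Qed.

Definition lump (F : 'I_T -> 'I_K -> R) : R :=
  (n.+2%:R)^-1 * \sum_j area j * \sum_i F j (elt j i).

Definition vtx_filter (j : 'I_T) i : set_system point :=
  within (osimplex j) (nbhs (vtx (elt j i))).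

Lemma vtx_filter_proper (j : 'I_T) i : ProperFilter (vtx_filter j i).
Proof.
by rewrite /vtx_filter; have := within_osimplex_proper hG (csimplex_vtx j i).
Qed.

Lemma lumpedE h F :
  (forall j i, h j x @[x --> vtx_filter j i] --> F j (elt j i)) ->
  lumped h = lump F.
Proof.
move=> hF; rewrite /lumped /lump; congr (_ * _).
apply: eq_bigr => j _; congr (_ * _); apply: eq_bigr => i _.
have PF := vtx_filter_proper j i.
by apply: cvg_lim => //; exact: hF.
Qed.

Lemma Vh_cvg f (j : 'I_T) i : Vh G f ->
  f x @[x --> vtx_filter j i] --> f (vtx (elt j i)).
Proof.
move=> Vf; apply: Vh_within Vf _ (@osimplex_Gamma _ _ _ j).
exact: vtx_Gamma hG _.
Qed.

Lemma vec_cvg f (j : 'I_T) i : vec (@Vh R n G) f ->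
  ecvg (vtx_filter j i) f (f (vtx (elt j i))).
Proof. by move=> Vf r c; rewrite (ord1 c); exact: Vh_cvg (Vf r). Qed.

Lemma osimplex_cvg (j : 'I_T) i (h : point -> R) c :
  (forall x, osimplex j x -> h x = c) -> h x @[x --> vtx_filter j i] --> c.
Proof.
move=> hc; have FF := vtx_filter_proper j i.
have h0 : c @[x --> vtx_filter j i] --> c by exact: cvg_cst.
apply: cvg_trans h0; apply: near_eq_cvg.
change (nbhs (vtx (elt j i)) [set x | osimplex j x -> c = h x]).
by apply: filterE => x /hc.
Qed.

Lemma sgradv_cvg f (j : 'I_T) i : vec (@Vh R n G) f ->
  ecvg (vtx_filter j i) (sgradv f j) (dgradv j (nval f)).
Proof.
move=> Vf r c; apply: osimplex_cvg => x jx.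
by rewrite sgradv_Vh.
Qed.

Lemma sgrad_cvg f (j : 'I_T) i : Vh G f ->
  ecvg (vtx_filter j i) (sgrad f j) (dgrad j (nval f)).
Proof.
move=> Vf r c; apply: osimplex_cvg => x jx.
by rewrite sgrad_Vh.
Qed.

Lemma Vh_affine_fun (g : point) c : Vh G (fun x => c + ip g x).
Proof.
split; last by move=> j; exists g, c => x _; rewrite addrC.
apply: continuous_subspaceT => x.
by apply: (@cvgD _ _ _ (nbhs x)); [exact: cvg_cst|exact: continuous_ip].
Qed.

Lemma VhD f g (c : R) : Vh G f -> Vh G g -> Vh G (fun x => f x + c * g x).
Proof.
move=> [/subspace_continuousP fc fa] [/subspace_continuousP gc ga]; split.
  apply/subspace_continuousP => x Gx.
  apply: cvgD; first exact: fc.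
  by apply: cvgM; [exact: cvg_cst|exact: gc].
move=> j; have [u [p up]] := fa j; have [v [q vq]] := ga j.
exists (u + c *: v), (p + c * q) => x jx.
by rewrite up // vq // ipDl ipZl; ring.
Qed.

Lemma vec_id : vec (@Vh R n G) id.
Proof.
move=> r; rewrite (_ : (fun x => _) = fun x : point => 0 + ip (delta_mx r 0) x).
  exact: Vh_affine_fun.
by apply: funext => x; rewrite ipC ip_delta add0r.
Qed.

(** Regrouping serves to test with fields supported at a single vertex, and makes
    the sums over the simplices around a vertex appear that define its normal. *)
Lemma lump_vertices F : lump F =
  (n.+2%:R)^-1 * \sum_k \sum_(j | k \in elt_vertices j) area j * F j k.
Proof.
rewrite /lump; congr (_ * _).
rewrite (exchange_big_dep xpredT) //=; apply: eq_bigr => j _.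
rewrite mulr_sumr /elt_vertices big_imset //=.
by move=> i i' _ _; apply: elt_inj hG _ _ _.
Qed.

Lemma lump_eq F F' : (forall j i, F j (elt j i) = F' j (elt j i)) ->
  lump F = lump F'.
Proof.
move=> FF; rewrite /lump; congr (_ * _); apply: eq_bigr => j _; congr (_ * _).
by apply: eq_bigr => i _; apply: FF.
Qed.

Lemma lump_linear c F F' :
  lump (fun j k => c * F j k + F' j k) = c * lump F + lump F'.
Proof.
rewrite /lump mulrCA -mulrDr; congr (_ * _).
rewrite mulr_sumr -big_split /=; apply: eq_bigr => j _.
by rewrite big_split /= -mulr_sumr mulrDr mulrCA.
Qed.

Lemma lump_ge0 F : (forall j k, 0 <= F j k) -> 0 <= lump F.
Proof.
move=> F0; rewrite mulr_ge0 ?invr_ge0 ?ler0n //.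
apply: sumr_ge0 => j _; rewrite mulr_ge0 ?sumr_ge0 // ltW //.
Qed.

Lemma lump_eq0 F : (forall j k, 0 <= F j k) -> lump F = 0 ->
  forall j k, k \in elt_vertices j -> F j k = 0.
Proof.
move=> F0 /eqP; rewrite mulf_eq0 invr_eq0 pnatr_eq0 /=.
have S0 j : 0 <= \sum_i F j (elt j i) by apply: sumr_ge0.
rewrite psumr_eq0; last by move=> j _; rewrite mulr_ge0 // ltW.
move=> /allP h j k /imsetP [i _ ->].
have := h j; rewrite mem_index_enum => /(_ isT) /=.
rewrite mulf_eq0 gt_eqF //= psumr_eq0 // => /allP /(_ i).
by rewrite mem_index_enum => /(_ isT) /= /eqP.
Qed.

Lemma lump_delta (F : 'I_T -> 'I_K -> R) k :
  lump (fun j l => (l == k)%:R * F j l) =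
  (n.+2%:R)^-1 * \sum_(j | k \in elt_vertices j) area j * F j k.
Proof.
rewrite lump_vertices; congr (_ * _).
rewrite (bigD1 k) //= [X in _ + X]big1 ?addr0.
  by apply: eq_bigr => j _; rewrite eqxx mul1r.
by move=> l /negPf lk; rewrite big1 // => j _; rewrite lk mul0r mulr0.
Qed.

Definition vweight (k : 'I_K) : R := \sum_(j : 'I_T | k \in elt_vertices j) area j.

Lemma vweight_gt0 (k : 'I_K) : 0 < vweight k.
Proof.
case: hG => _ _ /(_ k) [j kj] _ _ _ _ _.
rewrite /vweight (bigD1 j) //= ltr_pwDl // sumr_ge0 // => l _.
exact: ltW.
Qed.

(** Mass lumping is diagonal, so the defining identity of the projected
    transport term can be solved vertex by vertex. *)
Definition dCh (a : 'I_K -> R) (b : 'I_K -> point) (k : 'I_K) : R :=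
  (vweight k)^-1 * \sum_(j | k \in elt_vertices j) area j * ip (b k) (dgrad j a).

Lemma Ch_Vh kappa eta : Vh G kappa -> vec (@Vh R n G) eta ->
  Vh G (Ch G kappa eta) /\
  forall k : 'I_K, Ch G kappa eta (vtx k) = dCh (nval kappa) (nval eta) k.
Proof.
move=> Vk Ve.
have lhsE c chi : Vh G c -> Vh G chi ->
    lumped (fun (j : 'I_T) x => c x * chi x) = lump (fun _ k => c (vtx k) * chi (vtx k)).
  move=> Vc Vchi; apply: lumpedE => j i.
  have FF := vtx_filter_proper j i.
  by apply: cvgM; exact: Vh_cvg.
have rhsE chi : Vh G chi ->
    lumped (fun (j : 'I_T) x => ip (eta x) (sgrad kappa j x) * chi x) =
    lump (fun j k => ip (eta (vtx k)) (dgrad j (nval kappa)) * chi (vtx k)).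
  move=> Vchi; apply: lumpedE => j i.
  have FF := vtx_filter_proper j i.
  apply: cvgM; last exact: Vh_cvg.
  by apply: cvg_ip; [exact: vec_cvg|exact: sgrad_cvg].
have w0 := vweight_gt0.
have [|VC CE] := @getPex _ [set c | Vh G c /\ forall chi, Vh G chi ->
     lumped (fun (j : 'I_T) x => c x * chi x) =
     lumped (fun (j : 'I_T) x => ip (eta x) (sgrad kappa j x) * chi x)].
  have [c [Vc cE]] := Vh_interpolation hG A1 (dCh (nval kappa) (nval eta)).
  exists c; split => // chi Vchi; rewrite lhsE // rhsE // !lump_vertices.
  congr (_ * _); apply: eq_bigr => k _.
  rewrite -mulr_suml cE /dCh mulrA -/(vweight k) mulrA divff ?gt_eqF // mul1r.
  by rewrite mulr_suml; apply: eq_bigr => j _; rewrite mulrA.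
split => // k.
have [d [Vd dE]] := Vh_interpolation hG A1 (fun l => (l == k)%:R).
have := CE d Vd; rewrite lhsE // rhsE //.
have h F : lump (fun j l => F j l * d (vtx l)) =
  (n.+2%:R)^-1 * \sum_(j | k \in elt_vertices j) area j * F j k.
  rewrite -lump_delta; apply: lump_eq => j i.
  by rewrite dE mulrC.
rewrite !h => /mulfI; rewrite invr_eq0 pnatr_eq0 => /(_ isT).
rewrite -mulr_suml -/(vweight k) /dCh => <-.
by rewrite mulrA mulVf ?mul1r // gt_eqF.
Qed.

End VertexValues.

Section Forms.
Variables (R : realType) (n : nat) (G : surface_data R n).
Local Notation point := 'cV[R]_n.+2.
Local Notation K := (nV G).
Local Notation T := (nT G).
Local Notation field := ('I_K -> point).
Local Notation nval f := (fun k : 'I_K => f (vtx k)).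
Local Notation one := (fun _ : 'I_K => 1 : R).

(** * The discrete forms *)

Lemma dgrad_linear (j : 'I_T) c (a b : 'I_K -> R) :
  dgrad j (fun k => c * a k + b k) = c *: dgrad j a + dgrad j b.
Proof.
rewrite /dgrad scalemxAr -mulmxDr; congr (_ *m _).
by apply/colP => l; rewrite !mxE; ring.
Qed.

Lemma dgradv_linear (j : 'I_T) c (a b : field) :
  dgradv j (c *: a + b) = c *: dgradv j a + dgradv j b.
Proof.
apply/matrixP => i l; rewrite [LHS]mxE.
have -> : (fun k => (c *: a + b) k i 0) = fun k => c * a k i 0 + b k i 0.
  by apply: funext => k; rewrite !fctE !mxE.
rewrite dgrad_linear [LHS]mxE [in LHS]mxE [RHS]mxE [in RHS]mxE.
by congr (_ * _ + _); rewrite [RHS]mxE.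
Qed.

Definition formN (w v : field) : R :=
  lump (fun (j : 'I_T) k => ip (w k) (nu j) * ip (v k) (nu j)).
Definition formP (w v : field) : R :=
  lump (fun (j : 'I_T) k => ip (proj j *m w k) (v k)).
Definition formM (w v : field) : R :=
  lump (fun (j : 'I_T) k => ip (w k) (v k)).
Definition formC (l : 'I_K -> R) (v : field) : R :=
  lump (fun (j : 'I_T) k => ip (l k *: nu j) (v k)).

Lemma formN_r c (u u' v : field) : formN v (c *: u + u') = c * formN v u + formN v u'.
Proof.
rewrite -lump_linear; apply: lump_eq => j i.
by rewrite fctE ipDl ipZl; ring.
Qed.

Lemma formN_l c (u u' v : field) : formN (c *: u + u') v = c * formN u v + formN u' v.
Proof.
rewrite -lump_linear; apply: lump_eq => j i.
by rewrite fctE ipDl ipZl; ring.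
Qed.

Lemma formP_r c (u u' v : field) : formP v (c *: u + u') = c * formP v u + formP v u'.
Proof.
rewrite -lump_linear; apply: lump_eq => j i.
by rewrite fctE ipDr ipZr.
Qed.

Lemma formP_l c (u u' v : field) : formP (c *: u + u') v = c * formP u v + formP u' v.
Proof.
rewrite -lump_linear; apply: lump_eq => j i.
by rewrite fctE mulmxDr -scalemxAr ipDl ipZl.
Qed.

Lemma formM_r c (u u' v : field) : formM v (c *: u + u') = c * formM v u + formM v u'.
Proof.
rewrite -lump_linear; apply: lump_eq => j i.
by rewrite fctE ipDr ipZr.
Qed.

Lemma formM_l c (u u' v : field) : formM (c *: u + u') v = c * formM u v + formM u' v.
Proof.
rewrite -lump_linear; apply: lump_eq => j i.
by rewrite fctE ipDl ipZl.
Qed.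

Lemma formC_r c (u u' : field) l : formC l (c *: u + u') = c * formC l u + formC l u'.
Proof.
rewrite -lump_linear; apply: lump_eq => j i.
by rewrite fctE ipDr ipZr.
Qed.

Lemma formC_l c (l l' : 'I_K -> R^o) (v : field) :
  formC (c *: l + l') v = c * formC l v + formC l' v.
Proof.
rewrite -lump_linear; apply: lump_eq => j i.
by rewrite fctE scalerDl ipDl !ipZl /GRing.scale /=; ring.
Qed.

Lemma stiff_r c (u u' v : field) : stiff v (c *: u + u') = c * stiff v u + stiff v u'.
Proof.
rewrite /stiff mulr_sumr -big_split /=; apply: eq_bigr => j _.
by rewrite dgradv_linear ipDr ipZr; ring.
Qed.

Lemma stiffC (u v : field) : stiff u v = stiff v u.
Proof. by apply: eq_bigr => j _; rewrite ipC. Qed.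

Lemma stiff_l c (u u' v : field) : stiff (c *: u + u') v = c * stiff u v + stiff u' v.
Proof. by rewrite !(stiffC _ v) stiff_r. Qed.

Lemma linear_form0 (V : lmodType R) (f : V -> R) :
  (forall c u u', f (c *: u + u') = c * f u + f u') -> f 0 = 0.
Proof.
move=> fl; have := fl (-1) 0 0; rewrite scaler0 addr0 => ->.
by rewrite mulN1r addNr.
Qed.

Lemma formN0l v : formN 0 v = 0.
Proof. by apply: (linear_form0 (f := formN^~ v)) => c u u'; exact: formN_l. Qed.
Lemma formN0r v : formN v 0 = 0.
Proof. by apply: linear_form0 => c u u'; exact: formN_r. Qed.
Lemma formP0l v : formP 0 v = 0.
Proof. by apply: (linear_form0 (f := formP^~ v)) => c u u'; exact: formP_l. Qed.
Lemma formP0r v : formP v 0 = 0.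
Proof. by apply: linear_form0 => c u u'; exact: formP_r. Qed.
Lemma formM0l v : formM 0 v = 0.
Proof. by apply: (linear_form0 (f := formM^~ v)) => c u u'; exact: formM_l. Qed.
Lemma formM0r v : formM v 0 = 0.
Proof. by apply: linear_form0 => c u u'; exact: formM_r. Qed.
Lemma formC0l v : formC 0 v = 0.
Proof. by apply: (linear_form0 (f := formC^~ v)) => c u u'; exact: formC_l. Qed.
Lemma formC0r v : formC v 0 = 0.
Proof. by apply: linear_form0 => c u u'; exact: formC_r. Qed.
Lemma stiff0l (v : field) : stiff 0 v = 0.
Proof. by apply: (linear_form0 (f := (@stiff R n G)^~ v)) => c u u'; exact: stiff_l. Qed.
Lemma stiff0r (v : field) : stiff v 0 = 0.
Proof. by apply: linear_form0 => c u u'; exact: stiff_r. Qed.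

Definition form0 := (formN0l, formN0r, formP0l, formP0r, formM0l, formM0r,
  formC0l, formC0r, stiff0l, stiff0r).

Hypothesis hG : polyhedral_surface G.
Hypothesis A1 : forall j : 'I_T, 0 < area j.

(** A positive multiple of the vertex normal ([nu_hp_vtx]), free of its
    denominator. *)
Definition wnormal (k : 'I_K) : point := \sum_(j | k \in elt_vertices j) area j *: nu j.

(** The normals enter the multiplier terms only through their area-weighted sums
    at the vertices. *)
Lemma formC_vertices l v :
  formC l v = (n.+2%:R)^-1 * \sum_k l k * ip (wnormal k) (v k).
Proof.
rewrite /formC (lump_vertices hG); congr (_ * _); apply: eq_bigr => k _.
rewrite /wnormal ip_suml mulr_sumr; apply: eq_bigr => j _.
by rewrite !ipZl; ring.
Qed.

Definition spike (V : lmodType R) (k : 'I_K) (v : V) : 'I_K -> V :=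
  fun l => if l == k then v else 0.

Lemma formC_spike_r l k v :
  formC l (spike k v) = (n.+2%:R)^-1 * (l k * ip (wnormal k) v).
Proof.
rewrite formC_vertices; congr (_ * _).
rewrite (bigD1 k) //= /spike eqxx big1 ?addr0 // => i /negPf ->.
by rewrite ip0r mulr0.
Qed.

Lemma formC_spike_l k v :
  formC (spike k (1 : R^o)) v = (n.+2%:R)^-1 * ip (wnormal k) (v k).
Proof.
rewrite formC_vertices; congr (_ * _).
rewrite (bigD1 k) //= /spike eqxx mul1r big1 ?addr0 // => i /negPf ->.
by rewrite mul0r.
Qed.

Lemma nu_hp_vtx (k : 'I_K) : nu_hp G (vtx k) = (vweight k)^-1 *: wnormal k.
Proof.
have -> : nu_hp G (vtx k) = vertex_normal_value k.
  apply/colP => i; rewrite mxE.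
  by have [_ ->] := nodalP hG A1 (fun l : 'I_K => vertex_normal_value l i 0).
rewrite /vertex_normal_value /vweight /wnormal.
have jE j : `[< csimplex j (vtx k) >] = (k \in elt_vertices j).
  apply/asboolP/idP => [/(vtx_in_csimplex hG A1)|] //.
  by move/(vtx_in_csimplex hG A1).
by congr (_^-1 *: _); apply: eq_bigl => j; exact: jE.
Qed.

Lemma stiff_ge0 (v : field) : 0 <= stiff v v.
Proof. by apply: sumr_ge0 => j _; rewrite mulr_ge0 ?ip_ge0 // ltW. Qed.

Lemma stiff_eq0 (v : field) : stiff v v = 0 ->
  forall (j : 'I_T) i i', v (elt j i) = v (elt j i').
Proof.
move=> /eqP; rewrite psumr_eq0; last by move=> j _; rewrite mulr_ge0 ?ip_ge0 // ltW.
move=> /allP h j; have := h j; rewrite mem_index_enum => /(_ isT) /=.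
rewrite mulf_eq0 gt_eqF //= ip_eq0 => /eqP dv.
suff cst i : v (elt j i) = v (elt j ord0) by move=> i i'; rewrite cst [RHS]cst.
apply/colP => r; rewrite -(aff_vtx A1 j (fun k => v k r 0)) /aff.
suff -> : dgrad j (fun k => v k r 0) = 0 by rewrite ip0l addr0.
by apply/colP => l; move/matrixP: dv => /(_ r l); rewrite !mxE.
Qed.

(** The union of the simplices carrying a given value and the union of the others
    are closed, and disjoint since intersecting simplices share a vertex; by
    connectedness one of them is empty. *)
Lemma connected_constant (V : eqType) (v : 'I_K -> V) : connected (Gamma G) ->
  (forall (j : 'I_T) i i', v (elt j i) = v (elt j i')) ->
  forall k k', v k = v k'.
Proof.
move=> conn vc.
pose val (j : 'I_T) := v (elt j ord0).
have valE (j : 'I_T) k : k \in elt_vertices j -> v k = val j.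
  by case/imsetP => i _ ->; apply: vc.
have meet (j j' : 'I_T) x : csimplex j x -> csimplex j' x -> val j = val j'.
  move=> jx j'x; case: hG => _ _ _ _ /(_ j j' x (conj jx j'x)) [t [_ tS t1 _]] _ _ _.
  have [|/existsPn h] := boolP [exists k, k \in elt_vertices j :&: elt_vertices j'].
    by case/existsP => k; rewrite inE => /andP [/valE <- /valE <-].
  move: t1; rewrite big1 => [/eqP|k _]; last exact: tS (h k).
  by rewrite eq_sym oner_eq0.
suff all j0 j : val j = val j0.
  move=> k k'; case: hG => _ _ cov _ _ _ _ _.
  have [j kj] := cov k; have [j' kj'] := cov k'.
  by rewrite (valE j) // (valE j') //; exact: all.
pose U (P : pred 'I_T) := \bigcup_(j in [set j | P j]) csimplex j.
have Ucl P : closed (U P).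
  apply: closed_bigcup => [|i _]; first exact: (@finite_finpred _ _ P).
  exact: csimplex_closed.
pose P j := val j == val j0.
have UG : U P = Gamma G.
  apply: conn.
  - exists (vtx (elt j0 ord0)); exists j0; first by rewrite /P /=.
    exact: csimplex_vtx.
  - exists (~` U (predC P)); first exact: closed_openC.
    apply/seteqP; split => x.
      move=> [i /= Pi ix]; split; first by exists i.
      by move=> [i' /= Pi' i'x]; move: Pi' Pi; rewrite /P (meet _ _ _ ix i'x) => /negP.
    move=> [[i _ ix] nU]; exists i => //=.
    by apply/negPn/negP => nP; apply: nU; exists i.
  - exists (U P); first exact: Ucl.
    apply/seteqP; split => x; last by case.
    by move=> [i Pi ix]; split; [exists i|exists i].
have : U P (vtx (elt j ord0)) by rewrite UG; exists j => //; exact: csimplex_vtx.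
by move=> [i /eqP <- ix]; apply: meet (csimplex_vtx j ord0) ix.
Qed.

Lemma ip_proj_self (j : 'I_T) (x : point) :
  ip (proj j *m x) x = ip (proj j *m x) (proj j *m x).
Proof.
rewrite (proj_nu j x); move: (nu j) (nu_unit A1 j) => v v1.
by rewrite !ipBl !ipBr !ipZl !ipZr v1 (ipC x v); ring.
Qed.

End Forms.

(** * The homogeneous discrete system *)

Section HomogeneousSystem.
Variables (R : realType) (n : nat) (G : surface_data R n).
Local Notation point := 'cV[R]_n.+2.
Local Notation K := (nV G).
Local Notation T := (nT G).
Local Notation field := ('I_K -> point).
Local Notation scalars := ('I_K -> R^o).

Definition vanishes_off (V : zmodType) (P : pred 'I_K) (a : 'I_K -> V) : Prop :=
  forall k, ~~ P k -> a k = 0.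

Lemma vanishes_off_spike (V : lmodType R) (P : pred 'I_K) k (v : V) :
  P k -> vanishes_off P (spike k v).
Proof. by move=> Pk l; rewrite /spike; case: eqP => // ->; rewrite Pk. Qed.

Variables (dt alpha : R) (theta : scalars) (fr0 fr1 : pred 'I_K).

Record discrete_system (r s : field -> R) (w k : field) (l : scalars) (p : field)
    (A V : R) : Prop := DiscreteSystem {
  ds_w : vanishes_off fr0 w;
  ds_k : vanishes_off fr1 k;
  ds_l : vanishes_off fr0 l;
  ds_p : vanishes_off fr0 p;
  ds_1 : forall chi : field, vanishes_off fr0 chi ->
    formN w chi - stiff k chi + formP chi p + alpha * stiff chi p
    + A * formC theta chi + V * formC (fun=> 1) chi = r chi;
  ds_2 : forall eta : field, vanishes_off fr1 eta ->
    formM k eta + dt * stiff w eta = s eta;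
  ds_3 : forall rho : scalars, vanishes_off fr0 rho -> formC rho p = 0;
  ds_4 : forall xi : field, vanishes_off fr0 xi ->
    formP w xi + formC l xi + alpha * stiff w xi = 0;
  ds_5 : formC (fun=> 1) w = 0;
  ds_6 : formC theta w = 0
}.

Hypothesis hdt : 0 < dt.
Hypothesis halpha : 0 <= alpha.
Hypothesis hG : polyhedral_surface G.
Hypothesis A1 : forall j : 'I_T, 0 < area j.
Hypothesis conn : connected (Gamma G).
Hypothesis fr01 : forall k, fr0 k -> fr1 k.
Hypothesis normal_neq0 : forall k, fr0 k -> wnormal k != 0.
Hypothesis normal_span : forall c : point,
  (forall k : 'I_K, fr0 k -> ip c (wnormal k) = 0) -> c = 0.
Hypothesis theta_neq : exists i j, [/\ fr0 i, fr0 j & theta i != theta j].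

Lemma covered (k : 'I_K) : exists j : 'I_T, k \in elt_vertices j.
Proof. by case: hG. Qed.

Lemma vanishes_off_mono (V : zmodType) (a : 'I_K -> V) :
  vanishes_off fr0 a -> vanishes_off fr1 a.
Proof. by move=> h k nk; apply: h; apply: contra nk; exact: fr01. Qed.

Let d0 : (n.+2%:R)^-1 != 0 :> R.
Proof. by rewrite invr_eq0 pnatr_eq0. Qed.

Lemma spike_eq0 l : (forall xi, vanishes_off fr0 xi -> formC l xi = 0) ->
  forall k, fr0 k -> l k = 0.
Proof.
move=> h k fk; have := h _ (vanishes_off_spike (wnormal k) fk).
rewrite formC_spike_r // => /eqP; rewrite mulf_eq0 (negPf d0) /= mulf_eq0.
by rewrite ip_eq0 (negPf (normal_neq0 fk)) orbF => /eqP.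
Qed.

Lemma spike_orth v : (forall rho, vanishes_off fr0 rho -> formC rho v = 0) ->
  forall k, fr0 k -> ip (wnormal k) (v k) = 0.
Proof.
move=> h k fk; have := h _ (vanishes_off_spike (1 : R^o) fk).
by rewrite formC_spike_l // => /eqP; rewrite mulf_eq0 (negPf d0) /= => /eqP.
Qed.

Lemma orth_formC l v : vanishes_off fr0 v ->
  (forall k, fr0 k -> ip (wnormal k) (v k) = 0) -> formC l v = 0.
Proof.
move=> van h; rewrite formC_vertices // big1 ?mulr0 // => k _.
by have [/h ->|/van ->] := boolP (fr0 k); rewrite ?ip0r mulr0.
Qed.

(** If x is not 0, then x = (nu_j . x) nu_j has a nonzero coefficient for each
    adjacent simplex; as x is orthogonal to the weighted normal, so is every
    nu_j, and the weighted normal is orthogonal to itself. *)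
Lemma normal_parallel (k : 'I_K) (x : point) : wnormal k != 0 ->
  ip (wnormal k) x = 0 ->
  (forall j : 'I_T, k \in elt_vertices j -> proj j *m x = 0) -> x = 0.
Proof.
move=> N0 Nx Px; apply/eqP/negPn/negP => x0; case/negP: N0.
have xE j : k \in elt_vertices j -> x = ip (nu j) x *: nu j.
  by move=> kj; apply/eqP; rewrite -subr_eq0 -proj_nu Px.
rewrite -ip_eq0 {1}/wnormal ip_suml big1 // => j kj.
rewrite ipZl; suff -> : ip (nu j) (wnormal k) = 0 by rewrite mulr0.
apply/eqP; have : ip (nu j) x != 0.
  by apply: contra x0 => /eqP e; rewrite (xE j kj) e scale0r.
move=> /mulfI h; apply/eqP/h; rewrite mulr0 -ipZl -(xE j kj).
by rewrite ipC.
Qed.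

Lemma formM_ge0 (v : field) : 0 <= formM v v.
Proof. by apply: lump_ge0 => // a b; exact: ip_ge0. Qed.

Lemma formN_ge0 (v : field) : 0 <= formN v v.
Proof. by apply: lump_ge0 => // a b; rewrite -expr2 sqr_ge0. Qed.

Lemma formP_ge0 (v : field) : 0 <= formP v v.
Proof. by apply: lump_ge0 => // a b; rewrite ip_proj_self // ip_ge0. Qed.

Lemma formM_eq0 (v : field) : formM v v = 0 -> v = 0.
Proof.
move=> v0; apply: funext => k; have [j kj] := covered k.
apply/eqP; rewrite -ip_eq0; apply/eqP.
by apply: (lump_eq0 A1 _ v0 kj) => a b; exact: ip_ge0.
Qed.

Lemma formN_eq0 (v : field) : formN v v = 0 ->
  forall (j : 'I_T) k, k \in elt_vertices j -> ip (v k) (nu j) = 0.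
Proof.
move=> v0 j k kj; apply/eqP; rewrite -[_ == 0]orbb -mulf_eq0; apply/eqP.
by apply: (lump_eq0 A1 _ v0 kj) => a b; rewrite -expr2 sqr_ge0.
Qed.

Lemma formP_eq0 (v : field) : formP v v = 0 ->
  forall (j : 'I_T) k, k \in elt_vertices j -> proj j *m v k = 0.
Proof.
move=> v0 j k kj; apply/eqP; rewrite -ip_eq0 -ip_proj_self //; apply/eqP.
by apply: (lump_eq0 A1 _ v0 kj) => a b; rewrite ip_proj_self // ip_ge0.
Qed.

(** The order of elimination is k, w, lambda, p and the two multipliers, each
    step using that the previous unknowns vanish. *)
Lemma homogeneous_trivial w k l p A V :
  discrete_system (fun=> 0) (fun=> 0) w k l p A V ->
  [/\ w = 0, k = 0, l = 0, p = 0 & A = 0 /\ V = 0].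
Proof.
case=> vw vk vl vp e1 e2 e3 e4 e5 e6.
have [i [j [fi fj tij]]] := theta_neq.
(* the energy identity: the terms coupling w and p cancel *)
have energy : dt * formN w w + formM k k = 0.
  have h1 := e1 w vw; have h2 := e2 k vk; have h4 := e4 p vp.
  rewrite e6 e5 !mulr0 !addr0 in h1; rewrite (e3 l vl) addr0 in h4.
  rewrite (stiffC k w) in h1.
  have -> : formN w w = stiff w k by lra.
  by rewrite addrC.
have M0 := formM_ge0 k.
have N0 : 0 <= dt * formN w w by rewrite mulr_ge0 ?formN_ge0 // ltW.
have k0 : k = 0 by apply: formM_eq0; lra.
have ww : formN w w = 0.
  apply/eqP; have : dt * formN w w == 0 by apply/eqP; lra.
  by rewrite mulf_eq0 gt_eqF.
have wnu := formN_eq0 ww.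
have sw : stiff w w = 0.
  have := e2 w (vanishes_off_mono vw); rewrite k0 formM0l // add0r => /eqP.
  by rewrite mulf_eq0 gt_eqF //= => /eqP.
have wc := connected_constant hG A1 conn (stiff_eq0 A1 sw).
have w0 : w = 0.
  apply: funext => a; rewrite (wc a i); apply: normal_span => b fb.
  rewrite /wnormal ip_sumr big1 // => c bc.
  by rewrite ipZr (wc i b) wnu // mulr0.
have l0 : l = 0.
  apply: funext => a; have [fa|/vl //] := boolP (fr0 a).
  apply: (spike_eq0 (l := l)) fa => xi vxi.
  by have := e4 xi vxi; rewrite w0 !form0 // mulr0 addr0 add0r.
have pN := spike_orth e3.
have pC c : formC c p = 0 by apply: orth_formC.
have p0 : p = 0.
  have := e1 p vp; rewrite w0 k0 !form0 // !pC !mulr0 !addr0 subr0 add0r => h.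
  have P0 := formP_ge0 p.
  have S0 : 0 <= alpha * stiff p p by rewrite mulr_ge0 ?stiff_ge0.
  have pp : formP p p = 0 by lra.
  apply: funext => a; have [fa|/vp //] := boolP (fr0 a).
  by apply: normal_parallel (normal_neq0 fa) (pN a fa) _ => b; exact: formP_eq0.
have AV a : fr0 a -> A * theta a + V = 0.
  move=> fa; apply: (spike_eq0 (l := fun a => A * theta a + V)) fa => xi vxi.
  have := e1 xi vxi; rewrite w0 k0 p0 !form0 // mulr0 !addr0 subr0 add0r => <-.
  rewrite -[V * _]addr0 -[X in _ = _ + (_ + X)](formC0l xi) -!formC_l.
  congr formC; apply: funext => b.
  by rewrite !fctE /GRing.scale /= mulr1 addr0.
have := AV i fi; have := AV j fj => hj hi.
have A0 : A = 0.
  apply/eqP; have : A * (theta i - theta j) == 0 by apply/eqP; lra.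
  by rewrite mulf_eq0 subr_eq0 (negPf tij) orbF.
by split => //; split => //; move: hi; rewrite A0 mul0r add0r.
Qed.

End HomogeneousSystem.

(** * Unique solvability of the discrete system *)

Section Extension.
Variables (R : realType) (I : finType) (P : pred I).

(** Fields vanishing off [P] are parametrized by functions on the subtype of
    [P], so that the unknowns range over a full vector space. *)
Definition extend (V : zmodType) (a : {ffun {k | P k} -> V}) : I -> V :=
  fun k => if insub k is Some i then a i else 0.

Lemma extend_off (V : zmodType) (a : {ffun {k | P k} -> V}) k :
  ~~ P k -> extend a k = 0.
Proof. by move=> nk; rewrite /extend insubN. Qed.

Lemma extend_linear (V : lmodType R) c (a b : {ffun {k | P k} -> V}) :
  extend (c *: a + b) = c *: extend a + extend b.
Proof.
apply: funext => k; rewrite !fctE /extend; case: insub => [i|].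
  by rewrite !ffunE.
by rewrite scaler0 addr0.
Qed.

Lemma extend_restrict (V : zmodType) (a : I -> V) : (forall k, ~~ P k -> a k = 0) ->
  extend [ffun i : {k | P k} => a (val i)] = a.
Proof.
move=> a0; apply: funext => k; rewrite /extend.
by case: insubP => [i _ <-|/a0 ->]; rewrite ?ffunE.
Qed.

Lemma extend_inj (V : zmodType) (a : {ffun {k | P k} -> V}) :
  extend a = 0 -> a = 0.
Proof.
move=> a0; apply/ffunP => i; rewrite [RHS]ffunE.
by have := congr1 (fun f => f (val i)) a0; rewrite /extend valK.
Qed.

End Extension.

Section SolvableSystem.
Variables (R : realType) (n : nat) (G : surface_data R n).
Local Notation point := 'cV[R]_n.+2.
Local Notation K := (nV G).
Local Notation T := (nT G).
Local Notation field := ('I_K -> point).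
Local Notation scalars := ('I_K -> R^o).
Variables (dt alpha : R) (theta : scalars) (fr0 fr1 : pred 'I_K).
Hypothesis hdt : 0 < dt.
Hypothesis halpha : 0 <= alpha.
Hypothesis hG : polyhedral_surface G.
Hypothesis A1 : forall j : 'I_T, 0 < area j.
Hypothesis conn : connected (Gamma G).
Hypothesis fr01 : forall k, fr0 k -> fr1 k.
Hypothesis normal_neq0 : forall k : 'I_K, fr0 k -> wnormal k != 0.
Hypothesis normal_span : forall c : point,
  (forall k : 'I_K, fr0 k -> ip c (wnormal k) = 0) -> c = 0.
Hypothesis theta_neq : exists i j, [/\ fr0 i, fr0 j & theta i != theta j].

Local Notation system := (discrete_system dt alpha theta fr0 fr1).
Let trivial := homogeneous_trivial hdt halpha hG A1 conn fr01 normal_neq0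
  normal_span theta_neq.

Lemma vanishes_linear (V : lmodType R) (P : pred 'I_K) c (a b : 'I_K -> V) :
  vanishes_off P a -> vanishes_off P b -> vanishes_off P (c *: a + b).
Proof. by move=> ha hb k nk; rewrite !fctE ha // hb // scaler0 addr0. Qed.

Lemma discrete_unique r s w k l p A V w' k' l' p' A' V' :
  system r s w k l p A V -> system r s w' k' l' p' A' V' ->
  [/\ w = w', k = k', l = l', p = p' & A = A' /\ V = V'].
Proof.
case=> vw vk vl vp e1 e2 e3 e4 e5 e6 [vw' vk' vl' vp' e1' e2' e3' e4' e5' e6'].
have [|dw dk dl dp [dA dV]] := @trivial ((-1) *: w + w') ((-1) *: k + k')
    ((-1) *: l + l') ((-1) *: p + p') ((-1) * A + A') ((-1) * V + V').
  split; try by apply: vanishes_linear.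
  - move=> chi vchi; have := e1 _ vchi; have := e1' _ vchi.
    rewrite formN_l stiff_l formP_r stiff_r => h h'.
    by rewrite -[RHS](subrr (r chi)) -{1}h -{1}h'; ring.
  - move=> eta veta; have := e2 _ veta; have := e2' _ veta.
    rewrite formM_l stiff_l => h h'.
    by rewrite -[RHS](subrr (s eta)) -{1}h -{1}h'; ring.
  - by move=> rho vr; rewrite formC_r e3 // e3' // mulr0 addr0.
  - move=> xi vx; have := e4 _ vx; have := e4' _ vx.
    rewrite formP_l stiff_l formC_l => h h'.
    by rewrite -[RHS](subrr 0) -{1}h -{1}h'; ring.
  - by rewrite formC_r e5 e5' mulr0 addr0.
  - by rewrite formC_r e6 e6' mulr0 addr0.
have eqP (U : lmodType R) (a b : U) : (-1) *: a + b = 0 -> a = b.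
  by rewrite scaleN1r addrC => /subr0_eq.
split; try exact: eqP.
by split; apply: (@eqP R^o).
Qed.

Lemma discrete_exists r s :
  (forall c (u v : field), r (c *: u + v) = c * r u + r v) ->
  (forall c (u v : field), s (c *: u + v) = c * s u + s v) ->
  exists w k l p A V, system r s w k l p A V.
Proof.
move=> rl sl.
pose X := ({ffun {k | fr0 k} -> point} * {ffun {k | fr1 k} -> point} *
  {ffun {k | fr0 k} -> R^o} * {ffun {k | fr0 k} -> point} * R^o * R^o)%type.
pose gw (x : X) := extend x.1.1.1.1.1.
pose gk (x : X) := extend x.1.1.1.1.2.
pose gl (x : X) := extend x.1.1.1.2.
pose gp (x : X) := extend x.1.1.2.
pose gA (x : X) : R := x.1.2.
pose gV (x : X) : R := x.2.
pose mk (w : field) (k : field) (l : scalars) (p : field) (A V : R^o) : X :=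
  ([ffun i : {k | fr0 k} => w (val i)], [ffun i : {k | fr1 k} => k (val i)],
   [ffun i : {k | fr0 k} => l (val i)], [ffun i : {k | fr0 k} => p (val i)], A, V).
pose b (x y : X) : R :=
  formN (gw x) (gw y) - stiff (gk x) (gw y) + formP (gw y) (gp x)
  + alpha * stiff (gw y) (gp x) + gA x * formC theta (gw y)
  + gV x * formC (fun=> 1) (gw y)
  + (formM (gk x) (gk y) + dt * stiff (gw x) (gk y))
  + formC (gl y) (gp x)
  + (formP (gw x) (gp y) + formC (gl x) (gp y) + alpha * stiff (gw x) (gp y))
  + gA y * formC (fun=> 1) (gw x) + gV y * formC theta (gw x).
have gl0 (g : X -> field) : g = gw \/ g = gk \/ g = gp ->
    forall c x y, g (c *: x + y) = c *: g x + g y.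
  by move=> [->|[->|->]] c x y; rewrite -extend_linear.
have wl := gl0 gw (or_introl erefl).
have kl := gl0 gk (or_intror (or_introl erefl)).
have pl := gl0 gp (or_intror (or_intror erefl)).
have ll c x y : gl (c *: x + y) = c *: gl x + gl y by rewrite -extend_linear.
have Al c x y : gA (c *: x + y) = c * gA x + gA y by [].
have Vl c x y : gV (c *: x + y) = c * gV x + gV y by [].
have off (P : pred 'I_K) (V : zmodType) (a : {ffun {k | P k} -> V}) :
    vanishes_off P (extend a) by move=> k; exact: extend_off.
have van0 (P : pred 'I_K) (V : zmodType) : vanishes_off P (0 : 'I_K -> V) by [].
(* testing with fields supported in one slot separates the equations *)
have solves r' s' x : r' 0 = 0 -> s' 0 = 0 ->
    (forall y, b x y = r' (gw y) + s' (gk y)) ->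
    system r' s' (gw x) (gk x) (gl x) (gp x) (gA x) (gV x).
  move=> r0 s0 h.
  have test chi eta rho xi A V : vanishes_off fr0 chi -> vanishes_off fr1 eta ->
      vanishes_off fr0 rho -> vanishes_off fr0 xi ->
      formN (gw x) chi - stiff (gk x) chi + formP chi (gp x)
      + alpha * stiff chi (gp x) + gA x * formC theta chi
      + gV x * formC (fun=> 1) chi
      + (formM (gk x) eta + dt * stiff (gw x) eta)
      + formC rho (gp x)
      + (formP (gw x) xi + formC (gl x) xi + alpha * stiff (gw x) xi)
      + A * formC (fun=> 1) (gw x) + V * formC theta (gw x) = r' chi + s' eta.
    move=> v1 v2 v3 v4; have := h (mk chi eta rho xi A V).
    rewrite /b.
    have -> : gw (mk chi eta rho xi A V) = chi by exact: extend_restrict.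
    have -> : gk (mk chi eta rho xi A V) = eta by exact: extend_restrict.
    have -> : gl (mk chi eta rho xi A V) = rho by exact: extend_restrict.
    by have -> : gp (mk chi eta rho xi A V) = xi by exact: extend_restrict.
  split; try exact: off.
  - move=> chi v; have := test chi 0 0 0 0 0 v (van0 _ _) (van0 _ _) (van0 _ _).
    by rewrite !form0 s0 !(mul0r, mulr0, oppr0, addr0, add0r).
  - move=> eta v; have := test 0 eta 0 0 0 0 (van0 _ _) v (van0 _ _) (van0 _ _).
    by rewrite !form0 r0 !(mul0r, mulr0, oppr0, addr0, add0r).
  - move=> rho v; have := test 0 0 rho 0 0 0 (van0 _ _) (van0 _ _) v (van0 _ _).
    by rewrite !form0 r0 s0 !(mul0r, mulr0, oppr0, addr0, add0r).
  - move=> xi v; have := test 0 0 0 xi 0 0 (van0 _ _) (van0 _ _) (van0 _ _) v.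
    by rewrite !form0 r0 s0 !(mul0r, mulr0, oppr0, addr0, add0r).
  - have := test 0 0 0 0 1 0 (van0 _ _) (van0 _ _) (van0 _ _) (van0 _ _).
    by rewrite !form0 r0 s0 !(mul0r, mulr0, oppr0, addr0, add0r, mul1r).
  - have := test 0 0 0 0 0 1 (van0 _ _) (van0 _ _) (van0 _ _) (van0 _ _).
    by rewrite !form0 r0 s0 !(mul0r, mulr0, oppr0, addr0, add0r, mul1r).
have [y||||u uE] := @nondegenerate_solvable R X b (fun x => r (gw x) + s (gk x)).
- move=> c x x'; rewrite /b wl kl ll pl Al Vl.
  rewrite !(formN_l, stiff_l, formP_l, formM_l, formC_l, formP_r, stiff_r, formC_r).
  by ring.
- move=> x c y y'; rewrite /b wl kl ll pl Al Vl.
  rewrite !(formN_r, stiff_r, formP_r, formM_r, formC_r, formP_l, stiff_l, formC_l).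
  by ring.
- by move=> c x y; rewrite wl kl rl sl; ring.
- move=> x bx.
  have [|x1 x2 x3 x4 [x5 x6]] := @trivial (gw x) (gk x) (gl x) (gp x) (gA x) (gV x).
    by apply: solves => // y; rewrite bx addr0.
  case: x x1 x2 x3 x4 x5 x6 bx => [[[[[xw xk] xl] xp] xA] xV].
  rewrite /gw /gk /gl /gp /gA /gV /=.
  by move=> /extend_inj -> /extend_inj -> /extend_inj -> /extend_inj -> -> ->.
- exists (gw u), (gk u), (gl u), (gp u), (gA u), (gV u).
  by apply: solves => //; apply: linear_form0.
Qed.

End SolvableSystem.

(** * From functions on the surface to vertex values and back *)

Section Translation.
Variables (R : realType) (n : nat) (G : surface_data R n).
Local Notation point := 'cV[R]_n.+2.
Local Notation K := (nV G).
Local Notation T := (nT G).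
Local Notation field := ('I_K -> point).
Local Notation scalars := ('I_K -> R^o).
Local Notation nval f := (fun k : 'I_K => f (vtx k)).
Local Notation VhV := (vec (@Vh R n G)).

(** The form [Rh] in terms of vertex values: the transport term has become
    explicit, and every term is linear in the test field. *)
Definition dRh (km : field) (kappa : scalars) (eta : field) : R :=
  \sum_j area j * (\tr (dgradv j km) * \tr (dgradv j eta))
  - lump (fun (j : 'I_T) _ => ip (dgradv j km)^T
      ((dgradv j eta + (dgradv j eta)^T) *m (dgradv j (@vtx R n G))^T))
  + lump (fun (j : 'I_T) k =>
      (ip (km k + kappa k *: nu j) (km k) - 2^-1 * ip (km k) (km k))
      * ip (dgradv j (@vtx R n G)) (dgradv j eta))
  - lump (fun (j : 'I_T) k => ip (kappa k *: km k) ((dgradv j eta)^T *m nu j))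
  + lump (fun (j : 'I_T) k => ip (dCh kappa eta k *: nu j) (km k)).

Lemma dCh_linear (a : scalars) c (u v : field) k :
  dCh a (c *: u + v) k = c * dCh a u k + dCh a v k.
Proof.
rewrite /dCh mulrCA -mulrDr; congr (_ * _).
rewrite mulr_sumr -big_split /=; apply: eq_bigr => j _.
by rewrite fctE ipDl ipZl; ring.
Qed.

Lemma dRh_linear km kappa c (u v : field) :
  dRh km kappa (c *: u + v) = c * dRh km kappa u + dRh km kappa v.
Proof.
have e1 : \sum_j area j * (\tr (dgradv j km) * \tr (dgradv j (c *: u + v))) =
    c * \sum_j area j * (\tr (dgradv j km) * \tr (dgradv j u)) +
    \sum_j area j * (\tr (dgradv j km) * \tr (dgradv j v)).
  rewrite mulr_sumr -big_split /=; apply: eq_bigr => j _.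
  by rewrite dgradv_linear mxtraceD mxtraceZ; ring.
have lin (H : 'I_T -> 'I_K -> field -> R) :
    (forall j k, H j k (c *: u + v) = c * H j k u + H j k v) ->
    lump (fun j k => H j k (c *: u + v)) =
    c * lump (fun j k => H j k u) + lump (fun j k => H j k v).
  by move=> Hl; rewrite -lump_linear; apply: lump_eq => j i; exact: Hl.
rewrite /dRh e1.
rewrite (lin (fun j _ eta => ip (dgradv j km)^T
      ((dgradv j eta + (dgradv j eta)^T) *m (dgradv j (@vtx R n G))^T))); last first.
  move=> j _; rewrite dgradv_linear linearD linearZ /= addrACA -scalerDr.
  by rewrite mulmxDl -scalemxAl ipDr ipZr.
rewrite (lin (fun j k eta =>
      (ip (km k + kappa k *: nu j) (km k) - 2^-1 * ip (km k) (km k))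
      * ip (dgradv j (@vtx R n G)) (dgradv j eta))); last first.
  by move=> j k; rewrite dgradv_linear ipDr ipZr; ring.
rewrite (lin (fun j k eta => ip (kappa k *: km k) ((dgradv j eta)^T *m nu j))); last first.
  move=> j k; rewrite dgradv_linear [(_ + _)^T]linearP /=.
  by rewrite mulmxDl -scalemxAl ipDr ipZr.
rewrite (lin (fun j k eta => ip (dCh kappa eta k *: nu j) (km k))); last first.
  by move=> j k; rewrite dCh_linear !ipZl; ring.
by ring.
Qed.

Hypothesis hG : polyhedral_surface G.
Hypothesis A1 : forall j : 'I_T, 0 < area j.

Lemma Rh_dRh km kappa eta : VhV km -> Vh G kappa -> VhV eta ->
  Rh G km kappa eta = dRh (nval km) (nval kappa) (nval eta).
Proof.
move=> Vkm Vk Ve; rewrite /Rh /dRh.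
have Vid := @vec_id R n G.
have [VC CE] := Ch_Vh hG A1 Vk Ve.
congr (_ - _ + _ - _ + _).
- apply: integral_Gamma_const => // j x jx.
  by rewrite /sdiv !(sgradv_Vh hG A1 _ jx).
- apply: (lumpedE hG) => j i; have FF := vtx_filter_proper hG j i.
  have e := @sgradv_cvg R n G hG A1 _ j i Ve.
  apply: cvg_ip => [a b|].
    rewrite mxE; under eq_fun do rewrite mxE.
    exact: (@sgradv_cvg R n G hG A1 _ j i Vkm).
  apply: ecvgM.
    by apply: ecvgD => // a b; rewrite mxE; under eq_fun do rewrite mxE; exact: e.
  move=> a b; rewrite mxE; under eq_fun do rewrite mxE.
  exact: (@sgradv_cvg R n G hG A1 _ j i Vid).
- apply: (lumpedE hG) => j i; have FF := vtx_filter_proper hG j i.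
  have ek := @vec_cvg R n G hG _ j i Vkm.
  apply: cvgM; last by apply: cvg_ip; exact: sgradv_cvg.
  apply: cvgB; last by apply: cvgM; [exact: cvg_cst|exact: cvg_ip].
  apply: cvg_ip => //; apply: ecvgD => //; apply: ecvgZ; first exact: Vh_cvg.
  exact: ecvg_cst.
- apply: (lumpedE hG) => j i; have FF := vtx_filter_proper hG j i.
  apply: cvg_ip.
    by apply: ecvgZ; [exact: Vh_cvg|exact: vec_cvg].
  apply: ecvgM; last exact: ecvg_cst.
  move=> a b; rewrite mxE; under eq_fun do rewrite mxE.
  exact: (@sgradv_cvg R n G hG A1 _ j i Ve).
- rewrite (@lumpedE R n G hG _
    (fun j k => ip (Ch G kappa eta (vtx k) *: nu j) (km (vtx k)))).
    by apply: lump_eq => j i; rewrite CE.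
  move=> j i; have FF := vtx_filter_proper hG j i.
  apply: cvg_ip; last exact: vec_cvg.
  by apply: ecvgZ; [exact: Vh_cvg|exact: ecvg_cst].
Qed.

Lemma lumped_formN w v : VhV w -> VhV v ->
  lumped (fun (j : 'I_T) x => ip (w x) (nu j) * ip (v x) (nu j)) =
  formN (nval w) (nval v).
Proof.
move=> Vw Vv; apply: (lumpedE hG) => j i; have FF := vtx_filter_proper hG j i.
by apply: cvgM; apply: cvg_ip; by [exact: vec_cvg|exact: ecvg_cst].
Qed.

Lemma lumped_formP w v : VhV w -> VhV v ->
  lumped (fun (j : 'I_T) x => ip (proj j *m w x) (v x)) =
  formP (nval w) (nval v).
Proof.
move=> Vw Vv; apply: (lumpedE hG) => j i; have FF := vtx_filter_proper hG j i.
apply: cvg_ip; last exact: vec_cvg.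
by apply: ecvgM; [exact: ecvg_cst|exact: vec_cvg].
Qed.

Lemma lumped_formC l v : Vh G l -> VhV v ->
  lumped (fun (j : 'I_T) x => ip (l x *: nu j) (v x)) =
  formC (nval l) (nval v).
Proof.
move=> Vl Vv; apply: (lumpedE hG) => j i; have FF := vtx_filter_proper hG j i.
apply: cvg_ip; last exact: vec_cvg.
by apply: ecvgZ; [exact: Vh_cvg|exact: ecvg_cst].
Qed.

Lemma lumped_formC1 v : VhV v ->
  lumped (fun (j : 'I_T) x => ip (nu j) (v x)) = formC (fun=> 1) (nval v).
Proof.
move=> Vv; rewrite (@lumpedE R n G hG _ (fun j k => ip (nu j) (v (vtx k)))).
  by apply: lump_eq => j i; rewrite scale1r.
move=> j i; have FF := vtx_filter_proper hG j i.
by apply: cvg_ip; [exact: ecvg_cst|exact: vec_cvg].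
Qed.

Lemma lumped_formMC k l v : VhV k -> Vh G l -> VhV v ->
  lumped (fun (j : 'I_T) x => ip (k x + l x *: nu j) (v x)) =
  formM (nval k) (nval v) + formC (nval l) (nval v).
Proof.
move=> Vk Vl Vv.
rewrite (@lumpedE R n G hG _ (fun j i => ip (k (vtx i) + l (vtx i) *: nu j) (v (vtx i)))).
  rewrite -[formM _ _]mul1r -lump_linear.
  by apply: lump_eq => j i; rewrite ipDl mul1r.
move=> j i; have FF := vtx_filter_proper hG j i.
apply: cvg_ip; last exact: vec_cvg.
by apply: ecvgD; [exact: vec_cvg|apply: ecvgZ; [exact: Vh_cvg|exact: ecvg_cst]].
Qed.

(** A point of a facet is a combination of the vertices of the facet alone, so
    boundary conditions are conditions on vertex values. *)
Lemma facets_zero (B : {set 'I_T * 'I_n.+2}) f : Vh G f ->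
  (forall k : 'I_K, facets_union B (vtx k) -> f (vtx k) = 0) ->
  forall x, facets_union B x -> f x = 0.
Proof.
move=> Vf f0 x [F FB [t [t0 tS t1 ->]]].
have tS' k : k \notin elt_vertices F.1 -> t k = 0.
  move=> kF; apply: tS; apply: contra kF => /imsetP [i _ ->].
  exact: imset_f.
rewrite (Vh_comb hG Vf t0 tS' t1) big1 // => k _.
have [kF|/tS ->] := boolP (k \in facet_vertices F); last by rewrite mul0r.
by rewrite f0 ?mulr0 //; exists F => //; exact: hull_vtx.
Qed.

Definition free0 (k : 'I_K) : bool := `[< ~ dGamma G (vtx k) >].
Definition free1 (k : 'I_K) : bool := `[< ~ d1Gamma G (vtx k) >].

Lemma free01 k : free0 k -> free1 k.
Proof.
move/asboolP => h; apply/asboolP => -[F F1 Fk]; apply: h; exists F => //.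
by case: hG => _ _ _ _ _ _ <- _; rewrite inE F1.
Qed.

Lemma Vh0P f : Vh0 G f <-> Vh G f /\ vanishes_off free0 (nval f : scalars).
Proof.
split=> -[Vf h]; split => //.
  by move=> k /negP nk; apply: h; apply: contrapT => hk; apply/nk/asboolP.
apply: facets_zero => // k kd; apply: h.
by apply/negP => /asboolP.
Qed.

Lemma Vh1P f : Vh1 G f <-> Vh G f /\ vanishes_off free1 (nval f : scalars).
Proof.
split=> -[Vf h]; split => //.
  by move=> k /negP nk; apply: h; apply: contrapT => hk; apply/nk/asboolP.
apply: facets_zero => // k kd; apply: h.
by apply/negP => /asboolP.
Qed.

Lemma vec_vanish (P : pred 'I_K) (V : (point -> R) -> Prop) f :
  (forall g, V g <-> Vh G g /\ vanishes_off P (nval g : scalars)) ->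
  vec V f <-> VhV f /\ vanishes_off P (nval f).
Proof.
move=> VP; split=> [h|[h1 h2] i].
  split=> [i|k nk]; first by have /VP [] := h i.
  by apply/colP => i; rewrite mxE; have /VP [_ /(_ k nk)] := h i.
by apply/VP; split => [|k nk]; [exact: h1|rewrite h2 // mxE].
Qed.

Definition vec_Vh0 f := @vec_vanish free0 (@Vh0 R n G) f Vh0P.
Definition vec_Vh1 f := @vec_vanish free1 (@Vh1 R n G) f Vh1P.

Definition interp (a : field) (x : point) : point :=
  \col_i @nodal R n G (fun k => a k i 0) x.

Lemma interp_vec a : VhV (interp a).
Proof.
move=> i; rewrite (_ : (fun x => _) = @nodal R n G (fun k => a k i 0)).
  by have [] := nodalP hG A1 (fun k => a k i 0).
by apply: funext => x; rewrite mxE.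
Qed.

Lemma interp_vtx a : nval (interp a) = a.
Proof.
apply: funext => k; apply/colP => i; rewrite mxE.
by have [_ ->] := nodalP hG A1 (fun k => a k i 0).
Qed.

Lemma field_eq f g : VhV f -> VhV g -> nval f = nval g -> {in Gamma G, f =1 g}.
Proof.
move=> Vf Vg fg x Gx; apply/colP => i.
apply: (Vh_eq hG A1 (Vf i) (Vg i) _ Gx) => k.
by have -> := congr1 (fun h => h k) fg.
Qed.

Variables (dt alpha : R) (km : point -> point) (kappa : point -> R)
  (mu : point -> point) (bd : field).
Hypothesis hkm : VhV km.
Hypothesis hkappa : Vh G kappa.
Hypothesis hbd : forall eta, VhV eta ->
  integral_d2Gamma G (fun x => ip (mu x) (eta x)) = \sum_k ip (bd k) (eta (vtx k)).

Definition theta : scalars := nval (theta_A G km kappa).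

Definition rhs1 (chi : field) : R := dRh (nval km) (nval kappa) chi.
Definition rhs2 (eta : field) : R :=
  \sum_k ip (bd k) (eta k) - formC (nval kappa) eta - stiff (@vtx R n G) eta.

Lemma rhs2_linear c (u v : field) : rhs2 (c *: u + v) = c * rhs2 u + rhs2 v.
Proof.
rewrite /rhs2 formC_r stiff_r.
have -> : \sum_k ip (bd k) ((c *: u + v) k) =
    c * \sum_k ip (bd k) (u k) + \sum_k ip (bd k) (v k).
  rewrite mulr_sumr -big_split /=; apply: eq_bigr => k _.
  by rewrite fctE ipDr ipZr.
by ring.
Qed.

(** Test fields given by vertex values are realized by interpolation; conversely
    each term of the scheme is the corresponding discrete form of the vertex
    values. *)
Lemma helfrich_discrete w k l p A V :
  helfrich_solution G dt alpha km kappa mu w k l p A V <->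
  [/\ VhV w, VhV k, Vh G l, VhV p &
   discrete_system dt alpha theta free0 free1 rhs1 rhs2
     (nval w) (nval k) (nval l) (nval p) A V].
Proof.
have Vth : Vh G (theta_A G km kappa).
  by have [] := nodalP hG A1
    (fun k => ip (km (vtx k)) (nu_hp G (vtx k)) + kappa (vtx k)).
have E1 chi : VhV w -> VhV k -> VhV p -> VhV chi ->
  lumped (fun (j : 'I_T) x => ip (w x) (nu j) * ip (chi x) (nu j))
          - Bh G km k kappa chi
          + lumped (fun (j : 'I_T) x => ip (proj j *m chi x) (p x))
          + alpha * grad_form G chi p
          + A * lumped (fun (j : 'I_T) x => ip (theta_A G km kappa x *: nu j) (chi x))
          + V * lumped (fun (j : 'I_T) x => ip (nu j) (chi x)) =
  formN (nval w) (nval chi) - stiff (nval k) (nval chi) + formP (nval chi) (nval p)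
  + alpha * stiff (nval chi) (nval p)
  + A * formC theta (nval chi) + V * formC (fun=> 1) (nval chi) - rhs1 (nval chi).
  move=> Vw Vk Vp Vc.
  rewrite /Bh lumped_formN // !grad_formE // Rh_dRh // lumped_formP //.
  by rewrite lumped_formC // lumped_formC1 // /rhs1 /theta; ring.
have E2 eta : VhV w -> VhV k -> VhV eta ->
  lumped (fun (j : 'I_T) x => ip (k x + kappa x *: nu j) (eta x))
          + grad_form G (fun x => x + dt *: w x) eta
          - integral_d2Gamma G (fun x => ip (mu x) (eta x)) =
  formM (nval k) (nval eta) + dt * stiff (nval w) (nval eta) - rhs2 (nval eta).
  move=> Vw Vk Ve; rewrite lumped_formMC // hbd // grad_formE //; last first.
    move=> i; rewrite (_ : (fun x => _) = fun x : point => x i 0 + dt * w x i 0).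
      by apply: VhD; [exact: vec_id|exact: Vw].
    by apply: funext => x; rewrite !mxE.
  have -> : (fun k : 'I_K => vtx k + dt *: w (vtx k)) = dt *: nval w + @vtx R n G.
    by apply: funext => i; rewrite !fctE addrC.
  by rewrite stiff_l /rhs2; ring.
have E4 xi : VhV w -> Vh G l -> VhV xi ->
  lumped (fun (j : 'I_T) x => ip (proj j *m w x) (xi x))
  + lumped (fun (j : 'I_T) x => ip (l x *: nu j) (xi x))
  + alpha * grad_form G w xi =
  formP (nval w) (nval xi) + formC (nval l) (nval xi) + alpha * stiff (nval w) (nval xi).
  by move=> Vw Vl Vx; rewrite lumped_formP // lumped_formC // grad_formE.
have E5 : VhV w ->
  lumped (fun (j : 'I_T) x => ip (w x) (nu j)) = formC (fun=> 1) (nval w).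
  move=> Vw; rewrite -lumped_formC1 //; congr lumped.
  by apply: funext => j; apply: funext => x; rewrite ipC.
have scal (g : scalars) : vanishes_off free0 g ->
    exists f, [/\ Vh0 G f & nval f = g].
  move=> g0; have [f [Vf fE]] := Vh_interpolation hG A1 g.
  exists f; split; last exact: funext.
  by apply/Vh0P; split => // i ni; rewrite fE g0.
have int0 (g : field) : vanishes_off free0 g -> vec (@Vh0 R n G) (interp g).
  move=> g0; apply/vec_Vh0; split; first exact: interp_vec.
  by rewrite interp_vtx.
have int1 (g : field) : vanishes_off free1 g -> vec (@Vh1 R n G) (interp g).
  move=> g0; apply/vec_Vh1; split; first exact: interp_vec.
  by rewrite interp_vtx.
split.
  case=> /vec_Vh0 [Vw w0] /vec_Vh1 [Vk k0] /Vh0P [Vl l0] /vec_Vh0 [Vp p0].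
  move=> e1 e2 e3 e4 e5 e6; split => //; split => //.
  - move=> chi c0; have := e1 _ (int0 _ c0).
    rewrite E1 //; last exact: interp_vec.
    by rewrite interp_vtx => /esym/subr0_eq.
  - move=> eta c0; have := e2 _ (int1 _ c0).
    rewrite E2 //; last exact: interp_vec.
    by rewrite interp_vtx => /esym/subr0_eq.
  - move=> rho /scal [f [Vf <-]]; have := e3 _ Vf.
    by rewrite lumped_formC //; case/Vh0P: Vf.
  - move=> xi c0; have := e4 _ (int0 _ c0).
    rewrite E4 //; last exact: interp_vec.
    by rewrite interp_vtx => /esym.
  - by rewrite -E5.
  - by rewrite -lumped_formC.
move=> [Vw Vk Vl Vp [w0 k0 l0 p0 e1 e2 e3 e4 e5 e6]]; split.
- exact/vec_Vh0.
- exact/vec_Vh1.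
- exact/Vh0P.
- exact/vec_Vh0.
- by move=> chi /vec_Vh0 [Vc c0]; rewrite E1 // e1 // subrr.
- by move=> eta /vec_Vh1 [Vc c0]; rewrite E2 // e2 // subrr.
- by move=> rho /Vh0P [Vr r0]; rewrite lumped_formC // e3.
- by move=> xi /vec_Vh0 [Vx x0]; rewrite E4 // e4.
- by rewrite E5.
- by rewrite lumped_formC.
Qed.

End Translation.

(** * Unique solvability of the scheme *)

Theorem theorem5p3 (R : realType) (n : nat) (hd : n.+2 = 2%N \/ n.+2 = 3%N)
    (dt alpha : R) (hdt : 0 < dt) (halpha : 0 <= alpha)
    (G : surface_data R n) (hG : polyhedral_surface G)
    (hconn : connected (Gamma G))
    (km : 'cV[R]_n.+2 -> 'cV[R]_n.+2) (hkm : vec (@Vh R n G) km)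
    (kappa : 'cV[R]_n.+2 -> R) (hkappa : Vh G kappa)
    (mu : 'cV[R]_n.+2 -> 'cV[R]_n.+2)
    (hmu : exists2 M, vec (@Vh R n G) M & {in d2Gamma G, mu =1 M})
    (A1 : forall j : 'I_(nT G), 0 < area j)
    (A2 : \dim <<[seq nu_hp G (vtx k) | k <- enum 'I_(nV G)
                                       & `[< @free_vertex R n G k >]]>>%VS = n.+2)
    (A3 : forall k : 'I_(nV G), free_vertex k -> nu_hp G (vtx k) != 0)
    (B1 : exists i j : 'I_(nV G), [/\ free_vertex i, free_vertex j &
            theta_A G km kappa (vtx i) != theta_A G km kappa (vtx j)]) :
  (exists (w k : 'cV[R]_n.+2 -> 'cV[R]_n.+2) (lambda : 'cV[R]_n.+2 -> R)
      (p : 'cV[R]_n.+2 -> 'cV[R]_n.+2) (lA lV : R),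
    helfrich_solution G dt alpha km kappa mu w k lambda p lA lV) /\
  (forall (w k : 'cV[R]_n.+2 -> 'cV[R]_n.+2) (lambda : 'cV[R]_n.+2 -> R)
      (p : 'cV[R]_n.+2 -> 'cV[R]_n.+2) (lA lV : R)
      (w' k' : 'cV[R]_n.+2 -> 'cV[R]_n.+2) (lambda' : 'cV[R]_n.+2 -> R)
      (p' : 'cV[R]_n.+2 -> 'cV[R]_n.+2) (lA' lV' : R),
    helfrich_solution G dt alpha km kappa mu w k lambda p lA lV ->
    helfrich_solution G dt alpha km kappa mu w' k' lambda' p' lA' lV' ->
    [/\ {in Gamma G, w =1 w'}, {in Gamma G, k =1 k'},
        {in Gamma G, lambda =1 lambda'}, {in Gamma G, p =1 p'} &
        lA = lA' /\ lV = lV']).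
Proof.
have n1 : (n <= 1)%N by case: hd => -[->].
have [M VM muM] := hmu.
have [bd hbd] := boundary_functional hG n1 VM muM.
have fr01 : forall k, free0 k -> free1 k := free01 hG.
have N0 (k : 'I_(nV G)) : free0 k -> wnormal k != 0.
  move=> /asboolP /A3; rewrite nu_hp_vtx // scaler_eq0 negb_or.
  by case/andP.
have Nspan (c : 'cV[R]_n.+2) :
    (forall k : 'I_(nV G), free0 k -> ip c (wnormal k) = 0) -> c = 0.
  move=> cN; apply/eqP; rewrite -ip_eq0; apply/eqP.
  move: A2; set s := map _ _ => dimS.
  have : c \in <<in_tuple s>>%VS.
    suff -> : <<in_tuple s>>%VS = fullv by rewrite memvf.
    by apply/eqP; rewrite eqEdim subvf dimS dimvf /dim /= muln1 leqnn.
  move=> /coord_span {2}->; rewrite ip_sumr big1 // => i _.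
  rewrite ipZr; have : s`_i \in s by rewrite mem_nth.
  case/mapP => k; rewrite mem_filter => /andP [fk _] ->.
  by rewrite nu_hp_vtx // ipZr cN // !mulr0.
have th : exists i j : 'I_(nV G),
    [/\ free0 i, free0 j & theta km kappa i != theta km kappa j].
  have [i [j [fi fj ij]]] := B1; exists i, j; split => //.
    exact/asboolP.
  exact/asboolP.
have HD := helfrich_discrete hG A1 dt alpha hkm hkappa hbd.
split.
  have [w [k [l [p [A [V sol]]]]]] := discrete_exists hdt halpha hG A1 hconn fr01
    N0 Nspan th (dRh_linear (fun k => km (vtx k)) (fun k => kappa (vtx k)))
    (rhs2_linear kappa bd).
  have [f [Vf fE]] := Vh_interpolation hG A1 l.
  exists (interp w), (interp k), f, (interp p), A, V; apply/HD; split => //.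
  - exact: interp_vec.
  - exact: interp_vec.
  - exact: interp_vec.
  - by rewrite !interp_vtx // (_ : (fun k => f (vtx k)) = l) //; exact: funext.
move=> w k l p A V w' k' l' p' A' V' /HD [Vw Vk Vl Vp S] /HD [Vw' Vk' Vl' Vp' S'].
have [ew ek el ep eA] := discrete_unique hdt halpha hG A1 hconn fr01 N0 Nspan th S S'.
split => //; try exact: field_eq.
by apply: Vh_eq => // i; have -> := congr1 (fun h => h i) el.
Qed.
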